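(* Let $f:\mathbb{C}^2\to\mathbb{C}^2$ be a dissipative complex H\'enon map, with $|\det(df_x)|=b<1$, and let $J$ be its Julia set. Then $J$ has dominated splitting if and only if for every $\beta=(\beta_-,\beta_+)$ with $b<\beta_+\le\beta_-<1$, the set $\mathrm{Crit}(\beta)$ of $\beta$-critical points is empty.
   Context: A complex H\'enon map is a finite composition of maps of the form $(x,y)\mapsto(y,p(y)-ax)$ with $p$ a polynomial of degree at least two and $a\in\mathbb{C}^*$; its complex Jacobian determinant is constant. It is dissipative if $|\det(df_x)|=b<1$. Let $K^{\pm}$ be the set of points with bounded forward (resp. backward) $f$-orbit, $J^\pm=\partial K^\pm$ and $J=J^+\cap J^-$ the Julia set, a compact $f$-invariant set. Dominated splitting: $J$ has dominated splitting if there are a splitting $\mathbb{C}^2=E_z\oplus F_z$ ($z\in J$) into complex one-dimensional subspaces, invariant under $df$ (i.e. $df_z(E_z)=E_{f(z)}$, $df_z(F_z)=F_{f(z)}$), and an integer $l\ge 1$ such that $\|df^l_z|_{E_z}\|\cdot\|df^{-l}_{f^l(z)}|_{F_{f^l(z)}}\|<\tfrac12$ for every $z\in J$ (norms from the standard hermitian metric). For $x\in J$ and $n\in\mathbb{Z}$, let $F^n_x$ be the M\''obius transformation of the Riemann sphere $\overline{\mathbb{C}}=\mathbb{P}^1(\mathbb{C}^2)$ induced by $df^n_x$, i.e. $F^n_x([v])=[df^n_x v]$, and let $\|(F^n_x)'(\xi)\|$ be the norm of its derivative at $\xi\in\overline{\mathbb{C}}$ with respect to the spherical metric $2|dz|/(1+|z|^2)$.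 (Equivalently, $\|(F_x^n)'(\xi)\|=|\det df^n_x|/\|df^n_xv\|^2$, where $v$ is a unit vector with $[v]=\xi$.) A point $x\in J$ is a $\beta$-critical point if there exists a direction $\xi\in\overline{\mathbb{C}}$ such that for every $n\ge 0$: $\|(F^{n}_x)'(\xi)\|\ge\beta_+^{n}$ and $\|(F^{-n}_x)'(\xi)\|\ge\beta_-^{-n}$. *)

(* Defs.v *)
From HB Require Import structures.
From mathcomp Require Import all_boot all_order all_algebra.
From mathcomp Require Import complex.
From mathcomp Require Import all_classical all_reals all_analysis.

Set Implicit Arguments.
Unset Strict Implicit.
Unset Printing Implicit Defensive.

Import Order.TTheory GRing.Theory Num.Theory numFieldNormedType.Exports.
Import ComplexField.Normc.

Local Open Scope classical_set_scope.
Local Open Scope ring_scope.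
Local Open Scope complex_scope.

(* Makes R[i] a normed module over itself, so that 'rV[R[i]]_2 gets its
   topology and 'd its meaning as a complex differential. *)
#[warnings="-redundant-canonical-projection"]
HB.instance Definition _ (R : rcfType) := NormedModule.copy R[i] R[i]^o.

Notation C2 R := 'rV[R[i]]_2.

Section Henon.
Variable R : realType.
Local Notation C := R[i].

Definition pt (x y : C) : C2 R := \row_j (if j == 0 then x else y).

(* Library norms on R[i] and 'rV[R[i]]_2 are R[i]-valued, and the latter is the
   sup norm; this is the R-valued standard hermitian norm. *)
Definition hnorm (v : C2 R) : R := Num.sqrt (\sum_j (normc (v 0 j)) ^+ 2).

(* size p = 1 + deg p *)
Record henon_factor := HenonFactor {
  hpoly : {poly C};
  hcst : C;
  hpoly_deg : (2 < size hpoly)%N;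
  hcst_neq0 : hcst != 0 }.

Definition factor_map (h : henon_factor) (z : C2 R) : C2 R :=
  pt (z 0 1) ((hpoly h).[z 0 1] - hcst h * z 0 0).

Definition factor_inv (h : henon_factor) (z : C2 R) : C2 R :=
  pt (((hpoly h).[z 0 0] - z 0 1) / hcst h) (z 0 0).

Record henon := Henon {
  factors : seq henon_factor;
  factors_gt0 : (0 < size factors)%N }.

Definition henon_map (f : henon) : C2 R -> C2 R :=
  foldr (fun h g => factor_map h \o g) id (factors f).

Definition henon_inv (f : henon) : C2 R -> C2 R :=
  foldr (fun h g => g \o factor_inv h) id (factors f).

Lemma pt_eta (z : C2 R) : pt (z 0 0) (z 0 1) = z.
Proof.
by apply/rowP => j; rewrite mxE; case: j => [[|[|?]] ?] //=;
  congr (z _ _); apply/val_inj.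
Qed.

Lemma factor_mapK h : cancel (factor_map h) (factor_inv h).
Proof.
move=> z; rewrite /factor_inv /factor_map !mxE /= opprB addrC subrK mulrAC.
by rewrite divff ?hcst_neq0// mul1r pt_eta.
Qed.

Lemma factor_invK h : cancel (factor_inv h) (factor_map h).
Proof.
move=> z; rewrite /factor_inv /factor_map !mxE /= mulrC divfK ?hcst_neq0//.
by rewrite opprB addrC subrK pt_eta.
Qed.

Lemma henon_mapK f : cancel (henon_map f) (henon_inv f).
Proof.
rewrite /henon_map /henon_inv; elim: (factors f) => [|h s IH] z //=.
by rewrite factor_mapK IH.
Qed.

Lemma henon_invK f : cancel (henon_inv f) (henon_map f).
Proof.
rewrite /henon_map /henon_inv; elim: (factors f) => [|h s IH] z //=.
by rewrite IH factor_invK.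
Qed.

Definition henon_iter (f : henon) (n : int) : C2 R -> C2 R :=
  match n with
  | Posz k => iter k (henon_map f)
  | Negz k => iter k.+1 (henon_inv f)
  end.

Definition Kplus (f : henon) : set (C2 R) :=
  [set z | bounded_set [set henon_iter f n%:Z z | n in [set: nat]]].

Definition Kminus (f : henon) : set (C2 R) :=
  [set z | bounded_set [set henon_iter f (- n%:Z) z | n in [set: nat]]].

Definition boundary (A : set (C2 R)) : set (C2 R) := closure A `\` interior A.

Definition julia (f : henon) : set (C2 R) :=
  boundary (Kplus f) `&` boundary (Kminus f).

(* Operator norm of the restriction of a linear map L to the subspace U. *)
Definition opnorm (L : C2 R -> C2 R) (U : {vspace C2 R}) : R :=
  sup [set hnorm (L v) | v in [set v | v \in U /\ hnorm v = 1]].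

(* No continuity of the splitting is required. *)
Definition dominated_splitting (f : henon) (J : set (C2 R)) : Prop :=
  exists E F : C2 R -> {vspace C2 R},
    [/\ forall z, J z ->
          [/\ \dim (E z) = 1%N, \dim (F z) = 1%N,
              (E z + F z = fullv)%VS & (E z :&: F z = 0)%VS],
        forall z, J z ->
          (linfun ('d (henon_map f) z) @: E z)%VS = E (henon_map f z) /\
          (linfun ('d (henon_map f) z) @: F z)%VS = F (henon_map f z) &
        exists2 l : nat, (1 <= l)%N &
          forall z, J z ->
            let w := henon_iter f l%:Z z in
            opnorm ('d (henon_iter f l%:Z) z) (E z) *
            opnorm ('d (henon_iter f (- l%:Z)) w) (F w) < 2^-1].

(* The Riemann sphere P^1(C^2) is the set of xi : {vspace C2 R} with
   \dim xi = 1.  In the chart indexed by c : 'I_2, defined on the lines on which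
   coordinate c does not vanish, the coordinate is v_(1-c) / v_c for any nonzero
   v in xi.  Index 1 is z = v_0 / v_1 and index 0 is 1 / z. *)
Definition chart (c : 'I_2) (xi : {vspace C2 R}) : C :=
  vpick xi 0 (rev_ord c) / vpick xi 0 c.

Definition chart_inv (c : 'I_2) (t : C) : {vspace C2 R} :=
  <[\row_j (if j == c then 1 else t) : C2 R]>%VS.

Definition chart_at (xi : {vspace C2 R}) : 'I_2 :=
  if vpick xi 0 1 != 0 then 1 else 0.

(* Density of the spherical metric 2|dz| / (1 + |z|^2); the metric has this same
   expression in both charts. *)
Definition sph_density (t : C) : R := 2 / (1 + normc t ^+ 2).

(* Norm at xi, for the spherical metric, of the derivative of a self-map G of
   the sphere: the complex derivative in charts around xi and G xi, rescaled by
   the densities at the target and at the source. *)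
Definition sph_deriv (G : {vspace C2 R} -> {vspace C2 R})
    (xi : {vspace C2 R}) : R :=
  let c := chart_at xi in
  let t := chart c xi in
  let g := fun s : C => chart (chart_at (G xi)) (G (chart_inv c s)) in
  sph_density (g t) * normc (derive1 g t) / sph_density t.

Definition proj_diff (f : henon) (n : int) (x : C2 R) (xi : {vspace C2 R}) :
    {vspace C2 R} :=
  (linfun ('d (henon_iter f n) x) @: xi)%VS.

Definition Crit (f : henon) (beta_m beta_p : R) : set (C2 R) :=
  [set x | julia f x /\
    exists2 xi : {vspace C2 R}, \dim xi = 1%N &
      forall n : nat,
        beta_p ^+ n <= sph_deriv (proj_diff f n%:Z x) xi /\
        beta_m ^- n <= sph_deriv (proj_diff f (- n%:Z) x) xi].

End Henon.

(* Main.v *)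
Require Import Defs.
From mathcomp Require Import all_boot all_order all_algebra.
From mathcomp Require Import complex ring lra zify.
From mathcomp Require Import all_classical all_reals all_analysis.
Set Implicit Arguments.
Unset Strict Implicit.
Unset Printing Implicit Defensive.
Import Order.TTheory GRing.Theory Num.Theory numFieldNormedType.Exports.
Import ComplexField.Normc.
Local Open Scope classical_set_scope.
Local Open Scope ring_scope.
Local Open Scope complex_scope.

(** Let [A n x] be the Jacobian matrix of the [n]-th iterate at [x], acting on
    row vectors; its determinant has modulus [b ^ n]. The spherical derivative
    of the projectivized differential on the line of [v] is
    [b ^ n |v|^2 / |v A n x|^2] ([sph_deriv_line], [sph_deriv_jac]), so a
    critical point is a point of the Julia set with a vector [v] whose images
    are small in forward time and not too large in backward time. Both
    directions compare this with one fact about the dynamics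
    ([julia_not_contracting]): the differentials cannot contract all directions
    along the orbit of a point of the Julia set, since a neighbourhood of that
    point would then have bounded forward orbits.

    Domination excludes critical points. Domination makes the angle between [E]
    and [F] bounded below ([angle_bound]). If [v] had a component along [E],
    its backward images would outgrow [b ^ (- n / 2)], because in backward time
    the images of [E] exceed those of [F] while the product of the two is
    comparable to the determinant; hence the backward estimate
    forces [v] into [F] ([slow_backward_in_F]). The forward estimate then says
    that [F] contracts exponentially, and domination turns this into a
    contraction of the whole plane ([F_not_contracting]).

    Absence of critical points gives domination, and a single pair
    [(beta, beta)] is enough. Rescale to [B n x = (beta / b) ^ (n / 2) A n x].
    A critical direction is then a nonzero vector [v] with
    [|v B n x| <= |v|] for all integers [n]. If there is none, compactness
    gives a window size within which every vector is beaten by a definite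
    factor, so norms along an orbit have no approximate interior maximum
    ([peakless]): on a segment they are controlled by the values at the ends,
    and vectors with bounded forward (backward) orbits decay uniformly. At each
    point there is a forward bounded vector, because the determinants are at
    most one ([stable_exists]); there is only one such line, because a plane of
    them would be contracted ([stable_line]). Pushing forward vectors
    transverse to the stable lines of past points and passing to the limit
    gives backward bounded vectors ([unstable_exists]). These two invariant
    line fields decay in opposite times ([quasi_Anosov_splitting]); the
    rescaling cancels in the product that defines domination. *)

(** * Hermitian norm and area form on the complex plane squared *)

Section HermitianNorm.
Variable R : realType.
Local Notation C := R[i].
Local Notation T := (C2 R).
Implicit Types (v w : T) (k : C).

Lemma normcR (x : C) : `|x| = (normc x)%:C.
Proof. by rewrite normc_def; case: x. Qed.

Lemma normc_ge0 (x : C) : 0 <= normc x.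
Proof. by case: x => a c /=; exact: sqrtr_ge0. Qed.
Hint Resolve normc_ge0 : core.

Lemma normc_eq0 (x : C) : (normc x == 0) = (x == 0).
Proof.
by apply/eqP/eqP => [/eq0_normc//|->]; exact: normc0.
Qed.

Lemma normc_gt0 (x : C) : (0 < normc x) = (x != 0).
Proof. by rewrite lt_neqAle normc_ge0 andbT eq_sym normc_eq0. Qed.

Lemma ler_normcB (x y : C) : normc x - normc y <= normc (x - y).
Proof. by rewrite lerBlDr -{1}(subrK y x) le_normcD. Qed.

Lemma ler_normcDB (x y : C) : normc x - normc y <= normc (x + y).
Proof. by rewrite -{2}(opprK y) -(normcN y) ler_normcB. Qed.

Lemma normc_real (x : R) : normc x%:C = `|x|.
Proof. by rewrite /= expr0n addr0 sqrtr_sqr. Qed.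

Lemma normcX (x : C) n : normc (x ^+ n) = normc x ^+ n.
Proof. by elim: n => [|n IH]; rewrite ?expr0 ?normc1// !exprS normcM IH. Qed.

Lemma ord2P (k : 'I_2) : k = 0 \/ k = 1.
Proof. by case: k => [[|[|//]] kP]; [left|right]; exact: val_inj. Qed.

Lemma sum_I2 (V : zmodType) (F : 'I_2 -> V) : \sum_j F j = F 0 + F 1.
Proof.
rewrite !big_ord_recl big_ord0 addr0.
by congr (F _ + F _); exact: val_inj.
Qed.

Lemma hnormE v : hnorm v = Num.sqrt (normc (v 0 0) ^+ 2 + normc (v 0 1) ^+ 2).
Proof.
by rewrite /hnorm sum_I2.
Qed.

Lemma hnorm_normc v : hnorm v = normc (normc (v 0 0) +i* normc (v 0 1)).
Proof. exact: hnormE. Qed.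

Lemma hnorm_ge0 v : 0 <= hnorm v. Proof. exact: sqrtr_ge0. Qed.
Hint Resolve hnorm_ge0 : core.

Lemma sqr_hnorm v : hnorm v ^+ 2 = normc (v 0 0) ^+ 2 + normc (v 0 1) ^+ 2.
Proof. by rewrite hnormE sqr_sqrtr// addr_ge0// exprn_ge0. Qed.

Lemma row2P v w : v 0 0 = w 0 0 -> v 0 1 = w 0 1 -> v = w.
Proof. by move=> v0 v1; rewrite -(pt_eta v) -(pt_eta w) v0 v1. Qed.

Lemma hnormZ k v : hnorm (k *: v) = normc k * hnorm v.
Proof.
rewrite !hnormE !mxE !normcM !exprMn -mulrDr sqrtrM ?exprn_ge0//.
by rewrite sqrtr_sqr ger0_norm.
Qed.

Lemma hnorm0 : hnorm (0 : T) = 0.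
Proof. by rewrite hnormE !mxE normc0 expr0n addr0 sqrtr0. Qed.

Lemma hnorm_eq0 v : (hnorm v == 0) = (v == 0).
Proof.
apply/eqP/eqP => [v0|->]; last exact: hnorm0.
have /eqP := sqr_hnorm v.
rewrite v0 expr0n eq_sym paddr_eq0 ?exprn_ge0// !expf_eq0/= !normc_eq0.
by case/andP => /eqP z0 /eqP z1; apply: row2P; rewrite mxE.
Qed.

Lemma hnorm_gt0 v : (0 < hnorm v) = (v != 0).
Proof. by rewrite lt_neqAle hnorm_ge0 andbT eq_sym hnorm_eq0. Qed.

Lemma hnormN v : hnorm (- v) = hnorm v.
Proof. by rewrite -scaleN1r hnormZ normcN normc1 mul1r. Qed.

Lemma hnormBC v w : hnorm (v - w) = hnorm (w - v).
Proof. by rewrite -hnormN opprB. Qed.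

Lemma hnorm_mono (a c a' c' : R) : 0 <= a <= a' -> 0 <= c <= c' ->
  normc (a +i* c) <= normc (a' +i* c').
Proof.
move=> /andP[a0 aa] /andP[c0 cc] /=; apply: ler_wsqrtr.
by apply: lerD; apply: lerXn2r => //; rewrite nnegrE;
  [exact: le_trans aa|exact: le_trans cc].
Qed.

Lemma ler_hnormD v w : hnorm (v + w) <= hnorm v + hnorm w.
Proof.
rewrite !hnorm_normc; apply: (le_trans _ (le_normcD _ _)).
by apply: hnorm_mono; rewrite mxE normc_ge0 le_normcD.
Qed.

Lemma ler_hnormB v w : hnorm v - hnorm w <= hnorm (v - w).
Proof. by rewrite lerBlDr -{1}(subrK w v) ler_hnormD. Qed.

Lemma ler_coord v (j : 'I_2) : normc (v 0 j) <= hnorm v.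
Proof.
rewrite hnormE -[leLHS]ger0_norm// -sqrtr_sqr; apply: ler_wsqrtr.
by case: (ord2P j) => ->; rewrite ?lerDl ?lerDr exprn_ge0.
Qed.

Lemma hnorm_le_sum v : hnorm v <= normc (v 0 0) + normc (v 0 1).
Proof.
rewrite -(@ger0_norm _ (normc _ + _)) ?addr_ge0// -sqrtr_sqr hnormE.
by rewrite ler_wsqrtr// sqrrD addrAC lerDl mulrn_wge0// mulr_ge0.
Qed.

Lemma hnorm_pt (x y : C) :
  hnorm (pt x y) = Num.sqrt (normc x ^+ 2 + normc y ^+ 2).
Proof. by rewrite hnormE !mxE. Qed.

(** Up to the norms, the sine of the angle between the two complex lines. *)
Definition wedge v w : C := v 0 0 * w 0 1 - v 0 1 * w 0 0.

Lemma ler_wedge v w : normc (wedge v w) <= hnorm v * hnorm w.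
Proof.
apply: (le_trans (le_normcD _ _)); rewrite normcN !normcM.
rewrite !hnormE -sqrtrM ?addr_ge0 ?exprn_ge0//.
rewrite -[leLHS]ger0_norm ?addr_ge0 ?mulr_ge0// -sqrtr_sqr; apply: ler_wsqrtr.
set a := normc _; set b := normc _; set c := normc _; set d := normc _.
by rewrite -subr_ge0 (_ : _ - _ = (a * d - c * b) ^+ 2) ?sqr_ge0//; ring.
Qed.

Lemma det2 (M : 'M[C]_2) : \det M = M 0 0 * M 1 1 - M 0 1 * M 1 0.
Proof.
rewrite (expand_det_row _ 0) sum_I2 /cofactor !det_mx11 !mxE /=.
rewrite !expr0 expr1 mul1r mulN1r mulrN.
by congr (M _ _ * M _ _ - M _ _ * M _ _); exact: val_inj.
Qed.

Lemma mulmx2 v (M : 'M[C]_2) j : (v *m M) 0 j = v 0 0 * M 0 j + v 0 1 * M 1 j.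
Proof.
by rewrite mxE sum_I2.
Qed.

Lemma wedge_mul v w (M : 'M[C]_2) :
  wedge (v *m M) (w *m M) = wedge v w * \det M.
Proof. by rewrite /wedge !mulmx2 det2; ring. Qed.

Lemma wedgeZl k v w : wedge (k *: v) w = k * wedge v w.
Proof. by rewrite /wedge !mxE; ring. Qed.

Lemma wedgeZr k v w : wedge v (k *: w) = k * wedge v w.
Proof. by rewrite /wedge !mxE; ring. Qed.

Lemma wedgeC v w : wedge v w = - wedge w v.
Proof. by rewrite /wedge; ring. Qed.

Lemma wedge_cramer v w u :
  wedge v w *: u = wedge u w *: v + wedge v u *: w.
Proof. by apply: row2P; rewrite !mxE /wedge; ring. Qed.

Lemma wedge_eq0 v w : v != 0 -> wedge v w = 0 -> exists k, w = k *: v.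
Proof.
move=> v0; rewrite /wedge => /eqP; rewrite subr_eq0 => /eqP vw.
have [v00|v00] := eqVneq (v 0 0) 0.
  have v01 : v 0 1 != 0.
    by apply: contra_neq v0 => v01; apply: row2P; rewrite mxE.
    exists (w 0 1 / v 0 1); apply: row2P; rewrite !mxE ?divfK//.
  by apply: (mulfI v01); rewrite -vw v00; field.
exists (w 0 0 / v 0 0); apply: row2P; rewrite !mxE ?divfK//.
by apply: (mulfI v00); rewrite vw; field.
Qed.

End HermitianNorm.
#[global] Hint Extern 0 (is_true (@Order.le _ _ (@Algebra.zero _) (normc _))) =>
  solve [exact: normc_ge0] : core.
#[global] Hint Extern 0 (is_true (@Order.le _ _ (@Algebra.zero _) (hnorm _))) =>
  solve [exact: hnorm_ge0] : core.
(** * Topology in terms of the hermitian norm *)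

Section Topology.
Variable R : realType.
Local Notation C := R[i].
Local Notation T := (C2 R).

Lemma posc_real (e : C) : 0 < e -> exists2 r : R, 0 < r & e = r%:C.
Proof.
rewrite ltcE => /andP[/eqP i0 r0]; exists (complex.Re e) => //.
by case: e i0 {r0} => a c /= ->.
Qed.

Lemma nbhs_normcP (x : C) (P : set C) :
  nbhs x P <-> exists2 e : R, 0 < e & forall y, normc (y - x) < e -> P y.
Proof.
split=> [/nbhs_ballP[e /= e0 eP]|[e e0 eP]].
  have [r r0 er] := posc_real e0; exists r => // y yx; apply: eP.
  by rewrite -ball_normE /= er distrC normcR ltcR.
apply/nbhs_ballP; exists e%:C => /=; first by rewrite ltcR.
move=> y; rewrite -ball_normE /= distrC normcR ltcR; exact: eP.
Qed.

Lemma normc_continuous : continuous (@normc R).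
Proof.
move=> x P /nbhs_ballP[e /= e0 eP]; apply/nbhs_normcP; exists e => // y yx.
apply: eP; rewrite -ball_normE /= ltr_norml (le_lt_trans (ler_normcB _ _)) ?andbT.
  by rewrite ltrNl opprB (le_lt_trans (ler_normcB _ _)).
by rewrite -normcN opprB.
Qed.

Lemma nbhs_hnormP (x : T) (P : set T) :
  nbhs x P <-> exists2 e : R, 0 < e & forall y, hnorm (y - x) < e -> P y.
Proof.
split=> [|[e e0 eP]].
  move=> [Q Qx QP]; have /nbhs_normcP[d d0 dQ] := Qx 0 0.
  have /nbhs_normcP[d' d'0 dQ'] := Qx 0 1.
  exists (Num.min d d'); first by rewrite lt_min d0 d'0.
  move=> y; rewrite lt_min => /andP[yd yd']; apply: QP => i j; rewrite ord1.
  case: j => [[|[|//]] jP].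
    rewrite (_ : Ordinal jP = 0); last exact: val_inj.
    apply: dQ; rewrite (le_lt_trans _ yd)//.
    by rewrite (le_trans _ (ler_coord _ 0))// !mxE.
  rewrite (_ : Ordinal jP = 1); last exact: val_inj.
  apply: dQ'; rewrite (le_lt_trans _ yd')//.
  by rewrite (le_trans _ (ler_coord _ 1))// !mxE.
exists (fun i j => [set z | normc (z - x i j) < e / 2]).
  by move=> i j; apply/nbhs_normcP; exists (e / 2) => //; rewrite divr_gt0.
move=> y yx; apply: eP; rewrite (le_lt_trans (hnorm_le_sum _))// !mxE.
by rewrite [ltRHS]splitr ltrD//; exact: yx.
Qed.

Lemma hnorm_continuous : continuous (@hnorm R).
Proof.
move=> x P /nbhs_ballP[e /= e0 eP]; apply/nbhs_hnormP; exists e => // y yx.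
apply: eP; rewrite -ball_normE /= ltr_norml (le_lt_trans (ler_hnormB _ _)) ?andbT.
  by rewrite ltrNl opprB (le_lt_trans (ler_hnormB _ _)).
by rewrite hnormBC.
Qed.

Lemma row2_continuous (X : topologicalType) (u : X -> T) :
  continuous (fun p => u p 0 0) -> continuous (fun p => u p 0 1) ->
  continuous u.
Proof.
move=> u0 u1 x P /nbhs_hnormP[e e0 eP].
have e2 : 0 < e / 2 by rewrite divr_gt0.
have n0 : nbhs x [set y | normc (u y 0 0 - u x 0 0) < e / 2].
  have xn : nbhs (u x 0 0) [set z | normc (z - u x 0 0) < e / 2].
    by apply/nbhs_normcP; exists (e / 2).
  exact: u0 xn.
have n1 : nbhs x [set y | normc (u y 0 1 - u x 0 1) < e / 2].
  have xn : nbhs (u x 0 1) [set z | normc (z - u x 0 1) < e / 2].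
    by apply/nbhs_normcP; exists (e / 2).
  exact: u1 xn.
suff : nbhs x (u @^-1` P) by [].
apply: filterS (filterI n0 n1) => y /= [y0 y1]; apply: eP.
by rewrite (le_lt_trans (hnorm_le_sum _))// !mxE [ltRHS]splitr ltrD.
Qed.

Lemma coordE_continuous (j : 'I_2) : continuous (fun v : T => v 0 j).
Proof. exact: coord_continuous. Qed.

(** Heine-Borel in the complex plane squared, transported from the real plane. *)
Lemma compact_hball (M : R) : compact [set v : T | hnorm v <= M].
Proof.
pose sq : set (R * R) := `[- M, M] `*` `[- M, M].
have sqc : compact sq by apply: compact_setX; exact: segment_compact.
pose toC (p : R * R) : C := p.1 +i* p.2.
have toCc : continuous toC.
  move=> p P /nbhs_normcP[e e0 eP].
  have e2 : 0 < e / 2 by rewrite divr_gt0.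
  exists (ball p.1 (e / 2), ball p.2 (e / 2)).
    by split; exact: nbhsx_ballx.
  move=> [a c] /= []; rewrite -!ball_normE /= => pa pc; apply: eP.
  rewrite (_ : toC _ - _ = (a - p.1)%:C + 'i%C * (c - p.2)%:C).
    rewrite (le_lt_trans (le_normcD _ _))// normcM !normc_real.
    have -> : normc 'i%C = 1 :> R by rewrite /= expr0n add0r expr1n sqrtr1.
    rewrite mul1r.
    by rewrite [ltRHS]splitr ltrD// distrC.
  apply/eqP; rewrite eq_complex /toC /=.
  by apply/andP; split; apply/eqP; rewrite /=; ring.
have Kc : compact (toC @` sq).
  by apply: continuous_compact => //; exact: continuous_subspaceT.
have KKc := @rV_compact C 2 (fun=> toC @` sq) (fun=> Kc).
apply: (subclosed_compact _ KKc).
  have -> : [set v : T | hnorm v <= M] = @hnorm R @^-1` [set r | r <= M] by [].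
  by apply: closed_comp; [move=> ? _; exact: hnorm_continuous|exact: closed_le].
move=> v /= vM j; exists (complex.Re (v 0 j), complex.Im (v 0 j)); last first.
  by rewrite /toC /=; case: (v 0 j).
have := le_trans (ler_coord v j) vM; case: (v 0 j) => a c /= ac.
have [aM cM] : `|a| <= M /\ `|c| <= M.
  split; apply: le_trans ac; rewrite -sqrtr_sqr ler_wsqrtr// ?lerDl ?lerDr;
  exact: sqr_ge0.
by split; rewrite /= in_itv/= -ler_norml.
Qed.

Lemma hclosed_le (X : topologicalType) (u w : X -> R) :
  continuous u -> continuous w -> closed [set p | u p <= w p].
Proof.
move=> uc wc.
have -> : [set p | u p <= w p] = (fun p => u p - w p) @^-1` [set r | r <= 0].
  by apply/seteqP; split=> p /=; rewrite subr_le0.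
apply: closed_comp; last exact: closed_le.
by move=> p _; apply: continuousB; [exact: uc|exact: wc].
Qed.

Lemma compact_decreasing (X : topologicalType) (K : set X) (W : nat -> set X) :
  compact K -> (forall n, closed (W n)) ->
  (forall m n, (m <= n)%N -> W n `<=` W m) ->
  (forall n, exists2 x, K x & W n x) ->
  exists2 x, K x & forall n, W n x.
Proof.
move=> Kc Wc Wd Wn.
pose F := filter_from [set: nat] (fun n => K `&` W n).
have FF : ProperFilter F.
  apply: filter_from_proper; last by move=> n _; have [x] := Wn n; exists x.
  apply: filter_from_filter; first by exists 0%N.
  move=> m n _ _; exists (maxn m n) => // x [Kx Wx]; split; split=> //.
    by apply: Wd Wx; rewrite leq_maxl.
  by apply: Wd Wx; rewrite leq_maxr.
have [|x [Kx Fx]] := Kc F FF; first by exists 0%N => // ? [].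
exists x => // n; apply: (Wc n); rewrite closureEcluster => A B Wn' xB.
by apply: Fx => //; exists n => // y [_ /Wn'].
Qed.

Lemma bounded_hnormP (A : set T) :
  bounded_set A <-> exists M : R, forall z, A z -> hnorm z <= M.
Proof.
split=> [[_ [/complex_realP[r ->] AM]]|[M AM]].
  exists (2 * (r + 2)) => z Az.
  have zr : `|z| <= (r + 1)%:C by apply: AM Az; rewrite ltcR ltrDl.
  have zb : ball (0 : T) (r + 2)%:C z.
    rewrite -ball_normE /= sub0r normrN (le_lt_trans zr)// ltcR ltrD2l.
    by rewrite (_ : 2 = 1 + 1)// ltrDl.
  have [_ zc] := zb.
  have {}zc j : normc (z 0 j) <= r + 2.
    have := zc 0 j; rewrite -ball_normE /= mxE sub0r normrN normcR ltcR.
    exact: ltW.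
  by rewrite (le_trans (hnorm_le_sum _))// mulr_natl mulr2n lerD.
exists M%:C; split; first by apply/complex_realP; exists M.
move=> x /ltW Mx z Az; apply: le_trans Mx.
have [z0|z0] := eqVneq (`|z|) 0.
  by rewrite z0 ler0c (le_trans (hnorm_ge0 z) (AM _ Az)).
have [[i j] zE] := mx_norm_neq0 z0.
rewrite [`|z|]zE /= ord1 normcR lecR.
exact: le_trans (ler_coord _ _) (AM _ Az).
Qed.

Lemma continuous_addc (X : topologicalType) (u w : X -> C) :
  continuous u -> continuous w -> continuous (fun x => u x + w x).
Proof. by move=> uc wc x; exact: (cvgD (uc x) (wc x)). Qed.

Lemma continuous_mulc (X : topologicalType) (u w : X -> C) :
  continuous u -> continuous w -> continuous (fun x => u x * w x).
Proof. by move=> uc wc x; exact: (cvgM (uc x) (wc x)). Qed.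

Lemma continuous_compo (X Y Z : topologicalType) (u : X -> Y) (w : Y -> Z) :
  continuous u -> continuous w -> continuous (fun x => w (u x)).
Proof. by move=> uc wc x; exact: (continuous_comp (uc x) (wc (u x))). Qed.

Lemma continuous_pairc (X Y Z : topologicalType) (u : X -> Y) (w : X -> Z) :
  continuous u -> continuous w -> continuous (fun x => (u x, w x)).
Proof. by move=> uc wc x; exact: (cvg_pair (uc x) (wc x)). Qed.

Lemma poly_continuous (p : {poly C}) : continuous (fun t : C => p.[t]).
Proof.
elim/poly_ind: p => [|p c IH].
  have -> : (fun t => (0 : {poly C}).[t]) = cst 0.
    by apply/funext => s; rewrite horner0.
  exact: cst_continuous.
have -> : (fun t => (p * 'X + c%:P).[t]) = (fun t => p.[t] * t + c).
  by apply/funext => s; rewrite hornerMXaddC.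
apply: continuous_addc; last exact: cst_continuous.
by apply: continuous_mulc; [exact: IH|move=> t; exact: cvg_id].
Qed.

Lemma poly_slope (p : {poly C}) : exists q : C * C -> C,
  continuous q /\ forall s t, p.[t] - p.[s] = (t - s) * q (s, t).
Proof.
elim/poly_ind: p => [|p c [q [qc qP]]].
  exists (fun=> 0); split; first exact: cst_continuous.
  by move=> s t; rewrite !horner0 mulr0 subrr.
exists (fun st => p.[st.2] + st.1 * q st); split.
  apply: continuous_addc.
    apply: (@continuous_compo _ C _ snd) (@poly_continuous p).
    by move=> st; exact: cvg_snd.
  by apply: continuous_mulc; [move=> st; exact: cvg_fst|exact: qc].
move=> s t; rewrite !hornerMXaddC /=.
have -> : p.[t] = (t - s) * q (s, t) + p.[s] by rewrite -qP subrK.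
ring.
Qed.
End Topology.
(** * Difference quotients and differentials *)

Section Slopes.
Variable R : realType.
Local Notation C := R[i].
Local Notation T := (C2 R).
Implicit Types (g : T -> T) (Q : T * T -> 'M[C]_2).

(** A Caratheodory slope: a continuous matrix of difference quotients. Its
    values on the diagonal are the Jacobian matrices, and off the diagonal it
    replaces the mean value inequality. *)
Definition slope_of g Q :=
  (forall i j, continuous (fun p => Q p i j)) /\
  forall x y, g y - g x = (y - x) *m Q (x, y).

Lemma slope_continuous g Q : slope_of g Q -> continuous g.
Proof.
move=> [Qc gQ].
have gE y : g y = (y - 0) *m Q (0, y) + g 0 by rewrite -gQ subrK.
have gc j : continuous (fun y => g y 0 j).
  have -> : (fun y => g y 0 j) =
      (fun y => (y 0 0 * Q (0, y) 0 j + y 0 1 * Q (0, y) 1 j) + g 0 0 j).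
    by apply/funext => y; rewrite {1}gE mxE mulmx2 subr0.
  have Q0 i : continuous (fun y => Q (0, y) i j).
    apply: (@continuous_compo T (T * T)%type C (pair 0)) (Qc i j).
    by apply: continuous_pairc => y; [exact: cst_continuous|exact: cvg_id].
  apply: continuous_addc; last exact: cst_continuous.
  by apply: continuous_addc; apply: continuous_mulc => //; exact: coordE_continuous.
by apply: row2_continuous.
Qed.

Lemma slope_id : slope_of id (fun=> 1%:M).
Proof.
split=> [i j|x y]; last by rewrite mulmx1.
exact: cst_continuous.
Qed.

Lemma slope_comp g g' Q Q' : slope_of g Q -> slope_of g' Q' ->
  slope_of (g' \o g) (fun p => Q p *m Q' (g p.1, g p.2)).
Proof.
move=> gQ [Q'c g'Q']; have gc := slope_continuous gQ; case: gQ => Qc gQ.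
split=> [i j|x y]; last by rewrite /= g'Q' gQ mulmxA.
have -> : (fun p => (Q p *m Q' (g p.1, g p.2)) i j) =
    (fun p => Q p i 0 * Q' (g p.1, g p.2) 0 j + Q p i 1 * Q' (g p.1, g p.2) 1 j).
  by apply/funext => p; rewrite mxE sum_I2.
have Q'gc k : continuous (fun p : T * T => Q' (g p.1, g p.2) k j).
  apply: (@continuous_compo (T * T)%type (T * T)%type C
    (fun p => (g p.1, g p.2))) (Q'c k j).
  by apply: continuous_pairc;
    [apply: (@continuous_compo _ T _ fst) gc|apply: (@continuous_compo _ T _ snd) gc]
    => p; [exact: cvg_fst|exact: cvg_snd].
by apply: continuous_addc; apply: continuous_mulc => //; exact: Qc.
Qed.

Lemma slope_coord (j : 'I_2) (q : C * C -> C) : continuous q ->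
  continuous (fun p : T * T => q (p.1 0 j, p.2 0 j)).
Proof.
apply: (@continuous_compo (T * T)%type (C * C)%type C
  (fun p : T * T => (p.1 0 j, p.2 0 j))).
by apply: continuous_pairc;
  [apply: (@continuous_compo _ T _ fst) (@coordE_continuous R j)
  |apply: (@continuous_compo _ T _ snd) (@coordE_continuous R j)]
  => p; [exact: cvg_fst|exact: cvg_snd].
Qed.

Definition mx2 (a c d e : C) : 'M[C]_2 :=
  \matrix_(i, j) if i == 0 then if j == 0 then a else c
                 else if j == 0 then d else e.

Lemma mx2_continuous (X : topologicalType) (a c d e : X -> C) :
  continuous a -> continuous c -> continuous d -> continuous e ->
  forall i j, continuous (fun p => mx2 (a p) (c p) (d p) (e p) i j).
Proof.
move=> ac cc dc ec i j.
rewrite (_ : (fun p => _) = if i == 0 then if j == 0 then a else c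
                            else if j == 0 then d else e).
  by case: ifP => _; case: ifP.
by apply/funext => p; rewrite mxE; case: ifP => _; case: ifP.
Qed.

Lemma factor_slope (h : henon_factor R) : exists Q, slope_of (factor_map h) Q.
Proof.
have [q [qc qP]] := poly_slope (hpoly h).
exists (fun p : T * T => mx2 0 (- hcst h) 1 (q (p.1 0 1, p.2 0 1))); split.
  by apply: mx2_continuous; try exact: cst_continuous; exact: slope_coord.
move=> x y; apply: row2P; rewrite mulmx2 !mxE /=; first by ring.
have -> : (hpoly h).[y 0 1] = (y 0 1 - x 0 1) * q (x 0 1, y 0 1) +
  (hpoly h).[x 0 1] by rewrite -qP subrK.
ring.
Qed.

Lemma factor_inv_slope (h : henon_factor R) :
  exists Q, slope_of (factor_inv h) Q.
Proof.
have [q [qc qP]] := poly_slope (hpoly h).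
exists (fun p : T * T => mx2 (q (p.1 0 0, p.2 0 0) / hcst h) 1 (- (hcst h)^-1) 0); split.
  apply: mx2_continuous; try exact: cst_continuous.
  by apply: continuous_mulc; [exact: slope_coord|exact: cst_continuous].
move=> x y; apply: row2P; rewrite mulmx2 !mxE /=; last by ring.
rewrite mulrA -qP; ring.
Qed.

Lemma henon_map_slope (f : henon R) : exists Q, slope_of (henon_map f) Q.
Proof.
rewrite /henon_map; elim: (factors f) => [|h s [Q IH]] /=.
  by exists (fun=> 1%:M); exact: slope_id.
have [Q' hQ'] := factor_slope h; eexists; exact: (slope_comp IH hQ').
Qed.

Lemma henon_inv_slope (f : henon R) : exists Q, slope_of (henon_inv f) Q.
Proof.
rewrite /henon_inv; elim: (factors f) => [|h s [Q IH]] /=.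
  by exists (fun=> 1%:M); exact: slope_id.
have [Q' hQ'] := factor_inv_slope h; eexists; exact: (slope_comp hQ' IH).
Qed.

Lemma iter_slope g Q n : slope_of g Q -> exists Q', slope_of (iter n g) Q'.
Proof.
move=> gQ; elim: n => [|n [Q' IH]]; first by exists (fun=> 1%:M); exact: slope_id.
by eexists; exact: (slope_comp IH gQ).
Qed.

Lemma henon_iter_slope (f : henon R) n : exists Q, slope_of (henon_iter f n) Q.
Proof.
case: n => n.
  by have [Q fQ] := henon_map_slope f; exact: iter_slope fQ.
by have [Q fQ] := henon_inv_slope f; exact: iter_slope fQ.
Qed.

Lemma mulmxr_continuous (M : 'M[C]_2) : continuous (mulmxr M : T -> T).
Proof.
have Mc j : continuous (fun v : T => (v *m M) 0 j).
  rewrite (_ : (fun v : T => _) = fun v => v 0 0 * M 0 j + v 0 1 * M 1 j); last first.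
    by apply/funext => v; rewrite mulmx2.
  by apply: continuous_addc; apply: continuous_mulc => //;
    (exact: coordE_continuous || exact: cst_continuous).
by apply: row2_continuous.
Qed.


Lemma mx_norm_le (v : T) : `|v| <= (hnorm v)%:C.
Proof.
have [z0|z0] := eqVneq (`|v|) 0; first by rewrite z0 ler0c hnorm_ge0.
have [[i j] zE] := mx_norm_neq0 z0.
by rewrite [`|v|]zE /= ord1 normcR lecR ler_coord.
Qed.

Lemma hnorm_le_norm (v : T) : (hnorm v)%:C <= 2 * `|v|.
Proof.
suff vj j : (normc (v 0 j))%:C <= `|v|.
  rewrite (@le_trans _ _ ((normc (v 0 0))%:C + (normc (v 0 1))%:C))//.
    by rewrite -rmorphD lecR hnorm_le_sum.
  by rewrite mulr_natl mulr2n lerD.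
rewrite -normcR real_leNgt ?normr_real//; apply/negP => vlt.
have [_ /(_ 0 j)] : ball (0 : T) `|v 0 j| v.
  by rewrite -ball_normE /= sub0r normrN.
by rewrite -ball_normE /= mxE sub0r normrN ltxx.
Qed.

Lemma ler_mulmx_entry (v : T) (M : 'M[C]_2) (e : R) :
  (forall i j, normc (M i j) <= e) -> hnorm (v *m M) <= 4 * e * hnorm v.
Proof.
move=> Me; apply: le_trans (hnorm_le_sum _) _.
have vM j : normc ((v *m M) 0 j) <= 2 * e * hnorm v.
  rewrite mulmx2 (le_trans (le_normcD _ _))// !normcM.
  have := ler_pM (normc_ge0 _) (normc_ge0 _) (ler_coord v 0) (Me 0 j).
  have := ler_pM (normc_ge0 _) (normc_ge0 _) (ler_coord v 1) (Me 1 j).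
  lra.
have := vM 0; have := vM 1; lra.
Qed.

Lemma slope_diff g Q : slope_of g Q ->
  forall x, 'd g x = mulmxr (Q (x, x)) :> (T -> T).
Proof.
move=> [Qc gQ] x; apply: diff_unique; first exact: mulmxr_continuous.
apply/eqaddoP => _ /posnumP[e]; have [r r0 er] := posc_real (gt0 e).
have Dn i j : nbhs (0 : T)
    [set h | normc (Q (x, h + x) i j - Q (x, x) i j) < r / 8].
  have Qs : continuous (fun h : T => Q (x, h + x) i j).
    apply: (@continuous_compo T (T * T)%type C (fun h => (x, h + x))) (Qc i j).
    apply: continuous_pairc; first exact: cst_continuous.
    move=> h P /nbhs_hnormP[d d0 dP]; apply/nbhs_hnormP; exists d => // k kh.
    by apply: dP; rewrite opprD addrACA subrr addr0.
  apply: (Qs 0 [set z | normc (z - Q (x, x) i j) < r / 8]).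
  by rewrite add0r; apply/nbhs_normcP; exists (r / 8); rewrite ?divr_gt0.
apply: filterS (filterI (filterI (Dn 0 0) (Dn 0 1)) (filterI (Dn 1 0) (Dn 1 1))).
move=> h /= [[h00 h01] [h10 h11]].
have -> : (g \o shift x - (cst (g x) + mulmxr (Q (x, x)))) h =
    h *m (Q (x, h + x) - Q (x, x)).
  rewrite mulmxBr -[X in X *m _ - _](addrK x h) -gQ.
  by rewrite /cst /= opprD addrA.
rewrite er (le_trans (mx_norm_le _))//.
have he : hnorm (h *m (Q (x, h + x) - Q (x, x))) <= 4 * (r / 8) * hnorm h.
  apply: ler_mulmx_entry => i j; rewrite !mxE ltW//.
  by case: (ord2P i) => ->; case: (ord2P j) => ->.
apply: (@le_trans _ _ (4 * (r / 8) * hnorm h)%:C); first by rewrite lecR.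
rewrite rmorphM /=.
have r2 : r%:C = (4 * (r / 8))%:C * 2 :> C.
  have -> : (2 : C) = (2 : R)%:C by rewrite rmorph_nat.
  by rewrite -rmorphM; congr (_%:C); field.
rewrite r2 -mulrA.
by rewrite ler_wpM2l ?hnorm_le_norm// ler0c mulr_ge0// divr_ge0// ltW.
Qed.

Lemma slope_jacobian g Q : slope_of g Q -> forall x, 'J g x = Q (x, x).
Proof.
move=> gQ x; apply/row_matrixP => i; rewrite !rowE.
by rewrite /jacobian mul_rV_lin1 (slope_diff gQ).
Qed.

End Slopes.
(** * The Julia set is compact and invariant *)

Section Dynamics.
Variable R : realType.
Local Notation C := R[i].
Local Notation T := (C2 R).
Implicit Types (f : henon R) (z : T).

Lemma henon_iterS f (n : int) z :
  henon_iter f (n + 1) z = henon_map f (henon_iter f n z).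
Proof.
case: n => [n|[|n]]; first by rewrite -PoszD addn1.
  by rewrite /= henon_invK.
have -> : Negz n.+1 + 1 = Negz n by rewrite !NegzE -(addn1 n.+1) PoszD opprD subrK.
by rewrite /= henon_invK.
Qed.

Lemma henon_iterP f (n : int) z :
  henon_iter f (n - 1) z = henon_inv f (henon_iter f n z).
Proof. by rewrite -{2}(subrK 1 n) henon_iterS henon_mapK. Qed.

Lemma henon_iterD f (m n : int) z :
  henon_iter f (m + n) z = henon_iter f m (henon_iter f n z).
Proof.
elim/int_rec: m => [|m IH|m IH]; first by rewrite add0r.
  by rewrite -(addn1 m) PoszD addrAC !henon_iterS IH.
by rewrite -(addn1 m) PoszD opprD addrAC !henon_iterP IH.
Qed.

Lemma poly_large (p : {poly C}) (K : R) : (1 < size p)%N ->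
  exists2 r : R, 1 <= r & forall t : C, r <= normc t -> K <= normc p.[t].
Proof.
elim/poly_ind: p K => [|p c IH] K; first by rewrite size_poly0.
rewrite size_MXaddC; case: ifP => [//|_] sp.
have low (t : C) : normc p.[t] * normc t - normc c <= normc (p * 'X + c%:P).[t].
  rewrite hornerMXaddC -normcM.
  exact: ler_normcDB.
have [sp1|sp1] := ltnP 1 (size p).
  have [r r1 rP] := IH (`|K| + normc c) sp1; exists r => // t rt.
  apply: le_trans (low t); have := rP t rt; have := ler_norm K.
  have := normc_ge0 c; have := normr_ge0 K; have := le_trans r1 rt; nra.
have [d d0 pE] : exists2 d, d != 0 & p = d%:P.
  by apply/size_poly1P; rewrite eqn_leq sp1 -ltnS sp.
exists (1 + (`|K| + normc c) / normc d) => [|t dt].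
  by rewrite lerDl divr_ge0 ?addr_ge0 ?normc_ge0.
apply: le_trans (low t); rewrite pE hornerC lerBrDr mulrC -ler_pdivrMr ?normc_gt0//.
apply: le_trans dt; apply: le_trans (_ : (`|K| + normc c) / normc d <= _).
  by rewrite ler_pM2r ?invr_gt0 ?normc_gt0// lerD2r ler_norm.
by rewrite lerDr.
Qed.

Lemma poly_superlinear (p : {poly C}) (K : R) : (2 < size p)%N ->
  exists2 r : R, 1 <= r &
    forall t : C, r <= normc t -> K * normc t <= normc p.[t].
Proof.
elim/poly_ind: p => [|p c _]; first by rewrite size_poly0.
rewrite size_MXaddC; case: ifP => [//|_] sp.
have [r r1 rP] := poly_large (`|K| + normc c) (sp : (1 < size p)%N).
exists r => // t rt; rewrite hornerMXaddC.
have : normc p.[t] * normc t - normc c <= normc (p.[t] * t + c).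
  by rewrite -normcM; exact: ler_normcDB.
apply: le_trans; have := rP t rt; have := ler_norm K.
have := normc_ge0 c; have := normr_ge0 K; have := le_trans r1 rt; nra.
Qed.

(** The two ends of the Hubbard filtration; the factor two in the cone keeps
    their closed complements from meeting outside a bidisc. *)
Definition Vplus (r : R) z :=
  r <= normc (z 0 1) /\ normc (z 0 0) <= 2 * normc (z 0 1).
Definition Vminus (r : R) z :=
  r <= normc (z 0 0) /\ normc (z 0 1) <= 2 * normc (z 0 0).

(** Beyond this radius the polynomial term outweighs the linear one by enough to
    double the dominant coordinate, forwards and backwards. *)
Definition escape_radius (r : R) (h : henon_factor R) :=
  1 <= r /\ forall t : C, r <= normc t ->
    (2 * normc (hcst h) + 4) * normc t <= normc (hpoly h).[t].

Lemma escape_radius_ex (s : seq (henon_factor R)) :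
  exists r, forall r' h, List.In h s -> r <= r' -> escape_radius r' h.
Proof.
elim: s => [|h s [r IH]]; first by exists 0.
have [r' r1 r'P] := poly_superlinear (2 * normc (hcst h) + 4) (hpoly_deg h).
exists (Num.max r r') => r'' k /= kIn; rewrite ge_max => /andP[rr'' r'r''].
case: kIn => [<-|kIn]; last exact: IH.
by split=> [|t tr]; [exact: le_trans r'r''|apply: r'P; exact: le_trans tr].
Qed.

Lemma Vplus_factor r h z : escape_radius r h -> Vplus r z ->
  Vplus r (factor_map h z) /\ 2 * normc (z 0 1) <= normc (factor_map h z 0 1).
Proof.
move=> [r1 hr] [zr zz].
have grow : 2 * normc (z 0 1) <= normc (factor_map h z 0 1).
  rewrite !mxE /=; apply: le_trans (ler_normcB _ _); rewrite normcM.
  have := hr _ zr; have := normc_ge0 (hcst h); have := normc_ge0 (z 0 0); nra.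
split=> //; split.
  by apply: le_trans zr (le_trans _ grow); have := normc_ge0 (z 0 1); lra.
rewrite [factor_map h z 0 0]mxE /=; apply: le_trans (le_trans grow _).
  by have := normc_ge0 (z 0 1); lra.
by have := normc_ge0 (factor_map h z 0 1); lra.
Qed.

Lemma Vminus_factor r h z : escape_radius r h -> Vminus r z ->
  Vminus r (factor_inv h z) /\ 2 * normc (z 0 0) <= normc (factor_inv h z 0 0).
Proof.
move=> [r1 hr] [zr zz].
have h0 : 0 < normc (hcst h) by rewrite normc_gt0 hcst_neq0.
have grow : 2 * normc (z 0 0) <= normc (factor_inv h z 0 0).
  rewrite !mxE /= normcM normcV ler_pdivlMr//; apply: le_trans (ler_normcB _ _).
  have := hr _ zr; nra.
split=> //; split.
  by apply: le_trans zr (le_trans _ grow); have := normc_ge0 (z 0 0); lra.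
rewrite [factor_inv h z 0 1]mxE /=; apply: le_trans (le_trans grow _).
  by have := normc_ge0 (z 0 0); lra.
by have := normc_ge0 (factor_inv h z 0 0); lra.
Qed.

Lemma Vplus_henon f r z :
  (forall h, List.In h (factors f) -> escape_radius r h) -> Vplus r z ->
  Vplus r (henon_map f z) /\ 2 * normc (z 0 1) <= normc (henon_map f z 0 1).
Proof.
rewrite /henon_map; case: f => [[|h s] //= _] hr Vz.
have {hr} [hr sr] := (hr h (or_introl erefl), fun k ks => hr k (or_intror ks)).
have [Vs gs] : Vplus r (foldr (fun h g => factor_map h \o g) id s z) /\
    normc (z 0 1) <= normc (foldr (fun h g => factor_map h \o g) id s z 0 1).
  elim: s sr => [|k s IH] sr //=.
  have [Vs gs] := IH (fun k ks => sr k (or_intror ks)).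
  have [Vk gk] := Vplus_factor (sr k (or_introl erefl)) Vs; split=> //.
  by apply: le_trans gs (le_trans _ gk); rewrite mulr_natl mulr2n lerDl.
have [Vh gh] := Vplus_factor hr Vs; split=> //.
by apply: le_trans gh; rewrite ler_pM2l.
Qed.

Lemma Vminus_henon f r z :
  (forall h, List.In h (factors f) -> escape_radius r h) -> Vminus r z ->
  Vminus r (henon_inv f z) /\ 2 * normc (z 0 0) <= normc (henon_inv f z 0 0).
Proof.
rewrite /henon_inv; case: f => [[|h s] //= _] hr Vz.
have {hr} [hr sr] := (hr h (or_introl erefl), fun k ks => hr k (or_intror ks)).
have [Vh gh] := Vminus_factor hr Vz.
have [Vs gs] : Vminus r (foldr (fun h g => g \o factor_inv h) id s (factor_inv h z)) /\
    normc (factor_inv h z 0 0) <=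
    normc (foldr (fun h g => g \o factor_inv h) id s (factor_inv h z) 0 0).
  elim: s sr (factor_inv h z) Vh {gh} => [|k s IH] sr w Vw //=.
  have [Vk gk] := Vminus_factor (sr k (or_introl erefl)) Vw.
  have [Vs gs] := IH (fun k ks => sr k (or_intror ks)) _ Vk; split=> //.
  by apply: le_trans (le_trans gk gs); rewrite mulr_natl mulr2n lerDl.
by split=> //; apply: le_trans gs.
Qed.

Lemma not_doubling (u : nat -> R) (M : R) : 1 <= u 0%N ->
  (forall n, 2 * u n <= u n.+1) -> exists n, M < u n.
Proof.
move=> u0 uS.
have un n : n%:R + 1 <= u n.
  elim: n => [|n IH]; first by rewrite add0r.
  by have := uS n; rewrite -natr1; have := ler0n R n; lra.
exists (Num.truncn `|M|).+1; have := un (Num.truncn `|M|).+1.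
have /andP[_] := truncn_itv (normr_ge0 M); have := ler_norm M; lra.
Qed.

Lemma Kplus_cone f r z :
  (forall h, List.In h (factors f) -> escape_radius r h) -> 1 <= r ->
  Kplus f z -> ~ Vplus r z.
Proof.
move=> hr r1 /bounded_hnormP[M MP] Vz.
have Vn n : Vplus r (iter n (henon_map f) z).
  by elim: n => [//|n IH]; have [] := Vplus_henon hr IH.
have [|n|n Mn] := @not_doubling (fun n => normc (iter n (henon_map f) z 0 1)) M.
- exact: le_trans Vz.1.
- by have [] := Vplus_henon hr (Vn n).
have := MP _ (ex_intro2 _ _ n I erefl); apply/negP; rewrite -ltNge.
exact: lt_le_trans Mn (ler_coord _ _).
Qed.

Lemma Kminus_cone f r z :
  (forall h, List.In h (factors f) -> escape_radius r h) -> 1 <= r ->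
  Kminus f z -> ~ Vminus r z.
Proof.
move=> hr r1 /bounded_hnormP[M MP] Vz.
have Vn n : Vminus r (iter n (henon_inv f) z).
  by elim: n => [//|n IH]; have [] := Vminus_henon hr IH.
have [|n|n Mn] := @not_doubling (fun n => normc (iter n (henon_inv f) z 0 0)) M.
- exact: le_trans Vz.1.
- by have [] := Vminus_henon hr (Vn n).
have : hnorm (henon_iter f (- n%:Z) z) <= M by apply: MP; exists n.
have -> : henon_iter f (- n%:Z) z = iter n (henon_inv f) z by case: (n) => [|k].
apply/negP; rewrite -ltNge; exact: lt_le_trans Mn (ler_coord _ _).
Qed.

Lemma normc_coord_closed (i j : 'I_2) (a : R) (r : R) :
  closed [set z : T | normc (z 0 i) <= r \/ a * normc (z 0 i) <= normc (z 0 j)].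
Proof.
have nc k : continuous (fun z : T => normc (z 0 k)).
  by apply: (@continuous_compo T C R) (@normc_continuous R); exact: coordE_continuous.
apply: closedU; apply: hclosed_le => //; first exact: cst_continuous.
by move=> z; exact: (cvgM (cvg_cst a) (nc i z)).
Qed.

(** Points with bounded forward (backward) orbits avoid one end of the
    filtration, and so does their closure up to its boundary; what is left over
    by both ends lies in a bidisc. *)
Lemma julia_bounded f : exists r : R, forall z, julia f z -> hnorm z <= r.
Proof.
have [r rP] := escape_radius_ex (factors f).
pose r1 := Num.max 1 r.
have r11 : 1 <= r1 by rewrite le_max lexx.
have hr h : List.In h (factors f) -> escape_radius r1 h.
  by move=> hs; apply: rP hs _; rewrite le_max lexx orbT.
exists (r1 + r1) => z [[zp _] [zm _]].
have Kp : closed [set z : T | normc (z 0 1) <= r1 \/ 2 * normc (z 0 1) <= normc (z 0 0)].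
  exact: normc_coord_closed.
have Km : closed [set z : T | normc (z 0 0) <= r1 \/ 2 * normc (z 0 0) <= normc (z 0 1)].
  exact: normc_coord_closed.
have {}zp : normc (z 0 1) <= r1 \/ 2 * normc (z 0 1) <= normc (z 0 0).
  apply: Kp; apply: closure_subset zp => w /(Kplus_cone hr r11) wV /=.
  have [|w1] := leP (normc (w 0 1)) r1; [by left|right; rewrite leNgt].
  by apply/negP => w0; apply: wV; split; exact: ltW.
have {}zm : normc (z 0 0) <= r1 \/ 2 * normc (z 0 0) <= normc (z 0 1).
  apply: Km; apply: closure_subset zm => w /(Kminus_cone hr r11) wV /=.
  have [|w1] := leP (normc (w 0 0)) r1; [by left|right; rewrite leNgt].
  by apply/negP => w0; apply: wV; split; exact: ltW.
apply: le_trans (hnorm_le_sum _) _.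
by case: zp => zp; case: zm => zm;
  have := normc_ge0 (z 0 0); have := normc_ge0 (z 0 1); lra.
Qed.

Lemma julia_closed f : closed (julia f).
Proof.
apply: closedI; rewrite /boundary setDE; apply: closedI.
- exact: closed_closure.
- by apply: open_closedC; exact: open_interior.
- exact: closed_closure.
- by apply: open_closedC; exact: open_interior.
Qed.

Lemma julia_compact f : compact (julia f).
Proof.
have [r rP] := julia_bounded f.
exact: (subclosed_compact (@julia_closed f) (@compact_hball R r)).
Qed.

Lemma boundary_invariant (g g' : T -> T) (A : set T) :
  continuous g -> continuous g' -> cancel g g' ->
  (forall z, A (g z) <-> A z) -> forall z, boundary A z -> boundary A (g z).
Proof.
move=> gc g'c gK Ag z [zA zNA]; split.
  move=> B /gc /zA[w [Aw Bw]]; exists (g w); split=> //; exact/Ag.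
move=> gzA; apply: zNA; have gzA' : nbhs z (g @^-1` A) := gc z _ gzA.
by apply: filterS gzA' => w /= /Ag.
Qed.

Lemma bounded_shift (u : nat -> T) :
  bounded_set [set u n | n in [set: nat]] <->
  bounded_set [set u n.+1 | n in [set: nat]].
Proof.
split=> /bounded_hnormP[M MP]; apply/bounded_hnormP.
  by exists M => _ [n _ <-]; apply: MP; exists n.+1.
exists (Num.max (hnorm (u 0%N)) M) => _ [[|n] _ <-].
  by rewrite le_max lexx.
by rewrite le_max (MP (u n.+1)) ?orbT//; exists n.
Qed.

Lemma Kplus_invariant f z : Kplus f (henon_map f z) <-> Kplus f z.
Proof.
apply: iff_sym; apply: (iff_trans (bounded_shift (fun n => henon_iter f n%:Z z))).
rewrite /Kplus /= (_ : [set henon_iter f n%:Z (henon_map f z) | n in setT] =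
  [set henon_iter f n.+1%:Z z | n in setT])//.
by apply: eq_imagel => n _; rewrite /= -iterSr.
Qed.

Lemma Kminus_invariant f z : Kminus f (henon_map f z) <-> Kminus f z.
Proof.
apply: (iff_trans (bounded_shift
  (fun n => henon_iter f (- n%:Z) (henon_map f z)))).
rewrite /Kminus /= (_ : [set henon_iter f (- n.+1%:Z) (henon_map f z) | n in setT] =
  [set henon_iter f (- n%:Z) z | n in setT])//.
apply: eq_imagel => n _; rewrite -(addn1 n) PoszD opprD henon_iterD.
by rewrite -[henon_iter f (-1) _]/(henon_inv f _) henon_mapK.
Qed.

Lemma julia_invariant f (n : int) z : julia f z -> julia f (henon_iter f n z).
Proof.
have [Q fQ] := henon_map_slope f; have fc := slope_continuous fQ.
have [Q' fQ'] := henon_inv_slope f; have f'c := slope_continuous fQ'.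
have Kp w : Kplus f (henon_inv f w) <-> Kplus f w.
  by rewrite -Kplus_invariant henon_invK.
have Km w : Kminus f (henon_inv f w) <-> Kminus f w.
  by rewrite -Kminus_invariant henon_invK.
elim/int_rec: n => [//|n IH|n IH] Jz.
  have [IHp IHm] := IH Jz; rewrite -(addn1 n) PoszD henon_iterS; split.
    exact: (boundary_invariant fc f'c (@henon_mapK _ f) (@Kplus_invariant f)).
  exact: (boundary_invariant fc f'c (@henon_mapK _ f) (@Kminus_invariant f)).
have [IHp IHm] := IH Jz; rewrite -(addn1 n) PoszD opprD henon_iterP; split.
  exact: (boundary_invariant f'c fc (@henon_invK _ f) Kp).
exact: (boundary_invariant f'c fc (@henon_invK _ f) Km).
Qed.

End Dynamics.
(** * Jacobian cocycle and stability *)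

Section Jacobians.
Variable R : realType.
Local Notation C := R[i].
Local Notation T := (C2 R).
Implicit Types (f : henon R) (v : T).

Lemma compact_upper_bound (X : topologicalType) (K : set X) (u : X -> R) :
  compact K -> continuous u -> exists M, forall x, K x -> u x <= M.
Proof.
move=> Kc uc; apply: contrapT => noM.
have [k|m n mn x|n|x Kx ux] :=
    @compact_decreasing X K (fun n => [set x | n%:R <= u x]) Kc.
- by apply: hclosed_le => //; exact: cst_continuous.
- by apply: le_trans; rewrite ler_nat.
- apply: contrapT => nx; apply: noM; exists n%:R => x Kx; rewrite leNgt.
  by apply/negP => /ltW nux; apply: nx; exists x.
have := ux (Num.truncn `|u x|).+1; apply/negP; rewrite -ltNge.
have /andP[_] := truncn_itv (normr_ge0 (u x)); apply: le_lt_trans.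
exact: ler_norm.
Qed.

Lemma normc_compo_continuous (X : topologicalType) (u : X -> C) :
  continuous u -> continuous (fun x => normc (u x)).
Proof. by move=> uc; exact: (continuous_compo uc (@normc_continuous R)). Qed.

Lemma hnorm_compo_continuous (X : topologicalType) (u : X -> T) :
  continuous u -> continuous (fun x => hnorm (u x)).
Proof. by move=> uc; exact: (continuous_compo uc (@hnorm_continuous R)). Qed.

Lemma continuous_addr (X : topologicalType) (u w : X -> R) :
  continuous u -> continuous w -> continuous (fun x => u x + w x).
Proof. by move=> uc wc x; exact: (cvgD (uc x) (wc x)). Qed.

(** The entrywise sum of moduli: a norm whose continuity is immediate. *)
Definition entries (M : 'M[C]_2) : R :=
  (normc (M 0 0) + normc (M 0 1)) + (normc (M 1 0) + normc (M 1 1)).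

Lemma ler_entries (M : 'M[C]_2) v : hnorm (v *m M) <= 4 * entries M * hnorm v.
Proof.
have := normc_ge0 (M 0 0); have := normc_ge0 (M 0 1).
have := normc_ge0 (M 1 0); have := normc_ge0 (M 1 1) => m11 m10 m01 m00.
apply: ler_mulmx_entry => i j; rewrite /entries.
by case: (ord2P i) => ->; case: (ord2P j) => ->; lra.
Qed.

Lemma entries_continuous (X : topologicalType) (M : X -> 'M[C]_2) :
  (forall i j, continuous (fun p => M p i j)) -> continuous (fun p => entries (M p)).
Proof.
move=> Mc; apply: continuous_addr; apply: continuous_addr;
  exact: normc_compo_continuous.
Qed.

Definition jac f (n : int) x : 'M[C]_2 := 'J (henon_iter f n) x.

Lemma jac_slope f n Q x : slope_of (henon_iter f n) Q -> jac f n x = Q (x, x).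
Proof. by move=> fQ; rewrite /jac (slope_jacobian fQ). Qed.

Lemma jac1 f x : jac f 1 x = 'J (henon_map f) x.
Proof. by []. Qed.

Lemma diff_jac f n x v : 'd (henon_iter f n) x v = v *m jac f n x.
Proof.
have [Q fQ] := henon_iter_slope f n.
by rewrite (jac_slope x fQ) (slope_diff fQ).
Qed.
(* Conversion must not unfold iterates inside Jacobians. *)
Opaque jac.

Lemma jac_continuous f n i j : continuous (fun x => jac f n x i j).
Proof.
have [Q fQ] := henon_iter_slope f n.
have -> : (fun x => jac f n x i j) = (fun x => Q (x, x) i j).
  by apply/funext => x; rewrite (jac_slope x fQ).
apply: (@continuous_compo T (T * T)%type C (fun x => (x, x))) (fQ.1 i j).
by apply: continuous_pairc => x; exact: cvg_id.
Qed.

Lemma henon_iter_continuous f n : continuous (henon_iter f n).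
Proof. by have [Q fQ] := henon_iter_slope f n; exact: slope_continuous fQ. Qed.

Lemma jac0 f x : jac f 0 x = 1%:M.
Proof. exact: (@jac_slope f 0 (fun=> 1%:M) x (@slope_id R)). Qed.

Lemma jacD f (m n : int) x :
  jac f (m + n) x = jac f n x *m jac f m (henon_iter f n x).
Proof.
have [Q nQ] := henon_iter_slope f n; have [Q' mQ'] := henon_iter_slope f m.
have mn : slope_of (henon_iter f (m + n)) _ := eq_ind_r (fun g => slope_of g _)
  (slope_comp nQ mQ') (funext (henon_iterD f m n)).
by rewrite (jac_slope x mn) (jac_slope x nQ) (jac_slope _ mQ').
Qed.

Lemma jac_bound f (n : int) :
  exists2 M : R, 1 <= M & forall x v, julia f x ->
    hnorm (v *m jac f n x) <= M * hnorm v.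
Proof.
have [M MP] := compact_upper_bound (@julia_compact R f)
  (entries_continuous (@jac_continuous f n)).
exists (Num.max 1 (4 * M)) => [|x v Jx]; first by rewrite le_max lexx.
apply: le_trans (ler_entries _ _) _; apply: ler_wpM2r => //.
by rewrite le_max ler_pM2l ?MP ?orbT.
Qed.

Section Determinant.
Variables (f : henon R) (b : R).
Hypothesis hb : forall x : T, normc (\det ('J (henon_map f) x)) = b.

(** The inverse map is differentiable as well, so the Jacobian does not
    vanish. *)
Lemma henon_det_gt0 : 0 < b.
Proof.
rewrite -(hb 0) normc_gt0; apply/negP => /eqP d0.
have m1 : -1 + 1 = 0 :> int by [].
have := jacD f (-1) 1 0; rewrite m1 jac0 => /(congr1 determinant).
rewrite det1 det_mulmx => e.
have [d] : exists d, 1 = \det (jac f 1 0) * d by eexists; exact: e.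
by rewrite jac1 d0 mul0r => /eqP; rewrite oner_eq0.
Qed.

Lemma det_jacS (n : int) x :
  normc (\det (jac f (n + 1) x)) = normc (\det (jac f n x)) * b.
Proof.
rewrite addrC jacD det_mulmx normcM; congr (_ * _).
exact: hb.
Qed.

Lemma det_jac (n : int) x : normc (\det (jac f n x)) = b ^ n.
Proof.
have b0 : b != 0 by rewrite gt_eqF// henon_det_gt0.
elim/int_rec: n => [|n IH|n IH]; first by rewrite jac0 det1 normc1.
  by rewrite -(addn1 n) PoszD det_jacS IH expfzDr.
have nE : - n%:Z = - n.+1%:Z + 1 by rewrite -(addn1 n) PoszD opprD subrK.
apply: (mulIf b0); rewrite -det_jacS -nE IH nE expfzDr//.
Qed.

End Determinant.

(** Uniform continuity of the slope near the diagonal, by compactness: a limit of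
    counterexamples would be a discontinuity on the diagonal. *)
Lemma slope_uniform f g Q (e : R) : slope_of g Q -> 0 < e ->
  exists2 d : R, 0 < d <= 1 & forall x y, julia f x -> hnorm (y - x) <= d ->
    entries (Q (x, y) - Q (x, x)) < e.
Proof.
move=> [Qc _] e0; apply: contrapT => nod.
have [r rP] := julia_bounded f.
pose W n := [set p : T * T | hnorm (p.2 - p.1) <= n.+1%:R^-1] `&`
            [set p : T * T | e <= entries (Q p - Q (p.1, p.1))].
have Kc := compact_setX (@julia_compact R f) (@compact_hball R (r + 1)).
have fstc : continuous (fst : T * T -> T) by move=> p; exact: cvg_fst.
have sndc : continuous (snd : T * T -> T) by move=> p; exact: cvg_snd.
have Wc n : closed (W n).
  apply: closedI; apply: hclosed_le; try exact: cst_continuous.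
    apply: hnorm_compo_continuous.
    by move=> p; exact: (cvgB (sndc p) (fstc p)).
  apply: entries_continuous => i j.
  rewrite (_ : (fun p => _) = fun p => Q p i j - Q (p.1, p.1) i j); last first.
    by apply/funext => p; rewrite !mxE.
  have Qd : continuous (fun p : T * T => Q (p.1, p.1) i j).
    apply: (@continuous_compo (T * T)%type (T * T)%type C
      (fun p : T * T => (p.1, p.1))) (Qc i j).
    exact: (continuous_pairc fstc fstc).
  by move=> p; exact: (cvgB (Qc i j p) (Qd p)).
have Wd m n : (m <= n)%N -> W n `<=` W m.
  move=> mn p [/= pn pe]; split=> //=; apply: le_trans pn _.
  by rewrite lef_pV2 ?posrE// ler_nat ltnS.
have [n|[x y] [/= Jx _] Wxy] := compact_decreasing Kc Wc Wd.
  apply: contrapT => nW; apply: nod; exists n.+1%:R^-1.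
    by rewrite invr_gt0 ltr0n/= invf_le1 ?ler1n.
  move=> x y Jx yx; rewrite ltNge; apply/negP => ye; apply: nW.
  exists (x, y) => //; split=> //=; rewrite -(subrK x y).
  apply: le_trans (ler_hnormD _ _) _; rewrite addrC lerD ?rP//.
  by apply: le_trans yx _; rewrite invf_le1 ?ler1n.
have yx : y = x.
  apply/eqP; rewrite -subr_eq0 -hnorm_eq0; apply/negPn/negP => yx.
  have {}yx : 0 < hnorm (y - x) by rewrite lt_neqAle eq_sym yx hnorm_ge0.
  have [/= + _] := Wxy (Num.truncn (hnorm (y - x))^-1).
  apply/negP; rewrite -ltNge invf_plt ?posrE//.
  have /truncn_itv/andP[//] : 0 <= (hnorm (y - x))^-1 by rewrite invr_ge0.
have [_ /=] := Wxy 0%N; rewrite yx subrr /entries !mxE normc0 !addr0.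
by apply/negP; rewrite -ltNge.
Qed.

(** Stability: if the differentials of an iterate contract along the orbit of
    a point of the Julia set, so does the map itself near that orbit; a whole
    neighbourhood then has bounded orbits, which a boundary point of the set of
    bounded orbits excludes. *)
Lemma julia_not_contracting f x (N : nat) (c : nat -> R) (c0 m eta : R) :
  julia f x -> (0 < N)%N -> 0 < eta -> 0 < m < 1 ->
  (forall j, eta <= c j) ->
  (forall j v, hnorm (v *m jac f N (henon_iter f (N * j)%N x)) <= c j * hnorm v) ->
  (forall n, \prod_(j < n) c j <= c0 * m ^+ n) -> False.
Proof.
move=> Jx N0 eta0 /andP[m0 m1] ceta cv cprod.
have [Q fQ] := henon_iter_slope f N.
(* The slack between the contraction rate and 1 pays for the variation of
   the slopes inside a tube around the orbit. *)
pose t := m^-1; have t1 : 1 < t by rewrite /t invf_gt1.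
pose e := eta * (t - 1) / 4.
have e0 : 0 < e by rewrite divr_gt0// mulr_gt0// subr_gt0.
have [d /andP[d0 d1] dP] := slope_uniform f fQ e0.
pose xs j := henon_iter f (N * j)%N x.
have xsS j : xs j.+1 = henon_iter f N (xs j).
  by rewrite /xs -henon_iterD -PoszD mulnS.
have Jxs j : julia f (xs j) by exact: julia_invariant.
have step j y : hnorm (y - xs j) <= d ->
    hnorm (henon_iter f N y - xs j.+1) <= c j * t * hnorm (y - xs j).
  move=> yd; rewrite xsS fQ.2.
  have -> : Q (xs j, y) = Q (xs j, xs j) + (Q (xs j, y) - Q (xs j, xs j)).
    by rewrite addrC subrK.
  rewrite mulmxDr; apply: le_trans (ler_hnormD _ _) _.
  have := cv j (y - xs j); rewrite -/(xs j) (jac_slope _ fQ).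
  have := ler_entries (Q (xs j, y) - Q (xs j, xs j)) (y - xs j).
  have := dP _ _ (Jxs j) yd; have := hnorm_ge0 (y - xs j); have := ceta j.
  set E := entries _; set h := hnorm (y - _); move: (hnorm _) (hnorm _) => A B.
  move=> ce h0 Ee BE Ac.
  have : 4 * E * h <= eta * (t - 1) * h.
    by rewrite ler_wpM2r// -ler_pdivlMl// mulrC ltW.
  have : eta * (t - 1) * h <= c j * (t - 1) * h.
    by rewrite !ler_wpM2r// subr_ge0 ltW.
  lra.
pose c1 := Num.max 1 c0.
have c1_gt0 : 0 < c1 by rewrite lt_max ltr01.
have tube y n : hnorm (y - x) <= d / c1 ->
    hnorm (henon_iter f (N * n)%N y - xs n) <= d.
  move=> yx.
  have cp k : 0 <= \prod_(j < k) c j.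
    by apply: prodr_ge0 => j _; apply: le_trans (ceta j); exact: ltW.
  have bnd k : \prod_(j < k) c j * t ^+ k * hnorm (y - x) <= d.
    apply: le_trans (_ : c1 * hnorm (y - x) <= _); last first.
      by rewrite mulrC -ler_pdivlMr.
    apply: ler_wpM2r => //; rewrite -ler_pdivlMr ?exprn_gt0 ?(lt_trans ltr01)//.
    rewrite /t exprVn invrK; apply: le_trans (cprod k) _.
    by rewrite ler_wpM2r ?exprn_ge0 ?(ltW m0)// /c1 le_max lexx orbT.
  apply: le_trans (bnd n).
  elim: n => [|n IH]; first by rewrite big_ord0 expr0 !mul1r /xs muln0.
  rewrite mulnS PoszD henon_iterD; apply: le_trans (step _ _ (le_trans IH (bnd n))) _.
  rewrite big_ord_recr /= exprS.
  have ct : 0 <= c n * t.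
    by rewrite mulr_ge0 ?(le_trans _ (ceta n)) ?ltW// (lt_trans ltr01).
  have := ler_wpM2l ct IH; congr (_ <= _); ring.
have [r rP] := julia_bounded f.
have [M MP] : exists M, forall i y, (i < N)%N -> hnorm y <= r + 1 ->
    hnorm (henon_iter f i y) <= M.
  elim: (N) => [|k [M MP]]; first by exists 0.
  have [M' M'P] := compact_upper_bound (@compact_hball R (r + 1))
    (hnorm_compo_continuous (@henon_iter_continuous f k)).
  exists (Num.max M M') => i y; rewrite ltnS leq_eqVlt => /orP[/eqP->|ik] yr.
    by rewrite le_max M'P ?orbT.
  by rewrite le_max MP.
have [[_ nint] _] := Jx; apply: nint.
apply/nbhs_hnormP; exists (d / c1); first by rewrite divr_gt0.
move=> y /ltW yx; apply/bounded_hnormP; exists M => _ [n _ <-].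
rewrite (divn_eq n N) addnC PoszD henon_iterD mulnC; apply: MP.
  by rewrite ltn_mod.
move: (tube _ (n %/ N)%N yx) (rP _ (Jxs (n %/ N)%N)).
move: (henon_iter f _ y) (xs _) => w p wp pr.
by have := ler_hnormD (w - p) p; rewrite subrK; lra.
Qed.

End Jacobians.
(** * Sequences without interior peaks *)

Section Sequences.
Variable R : realType.
Implicit Types (g : int -> R).

Lemma geometric_small (lam S e : R) : 1 < lam -> 0 < e ->
  exists k : nat, S / lam ^+ k < e.
Proof.
move=> lam1 e0.
have bern (k : nat) : k%:R * (lam - 1) < lam ^+ k.
  elim: k => [|k IH]; first by rewrite mul0r expr0.
  have lk : 1 <= lam ^+ k by rewrite exprn_ege1// ltW.
  by rewrite exprS -natr1; nra.
pose a := `|S| / (e * (lam - 1)).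
have a0 : 0 <= a by rewrite divr_ge0// mulr_ge0 ?subr_ge0 ?ltW.
exists (Num.truncn a).+1; have /andP[_ ak] := truncn_itv a0.
rewrite ltr_pdivrMr ?exprn_gt0 ?(lt_trans ltr01)//.
apply: le_lt_trans (ler_norm S) _.
have -> : `|S| = e * (a * (lam - 1)).
  by rewrite /a; field; rewrite subr_eq0 !gt_eqF.
rewrite ltr_pM2l//; apply: lt_trans (bern _).
by rewrite ltr_pM2r ?subr_gt0.
Qed.

Variables (M lam : R) (N : nat).
Hypotheses (M1 : 1 <= M) (lam1 : 1 < lam).

(** Bi-infinite positive sequences with bounded ratios none of whose terms
    nearly dominates the N neighbours on each side: the norms of a vector along
    an orbit, when no vector is norm-maximal along its orbit. *)
Definition peakless g :=
  [/\ forall n, 0 < g n,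
      forall n, exists2 j : int, (`|j| <= N)%N & lam * g n <= g (n + j),
      forall n, g (n + 1) <= M * g n &
      forall n, g (n - 1) <= M * g n].

Lemma peakless_opp g : peakless g -> peakless (fun n => g (- n)).
Proof.
case=> g0 gw gS gP; split=> // n.
- have [j jN gj] := gw (- n); exists (- j); first by rewrite abszN.
  by rewrite opprD opprK.
- by rewrite opprD; exact: gP.
- by rewrite opprD opprK; exact: gS.
Qed.

Lemma peakless_growth g (k : nat) : peakless g -> forall n : int,
  g (n + k%:Z) <= M ^+ k * g n /\ g n <= M ^+ k * g (n + k%:Z).
Proof.
case=> g0 _ gS gP n; have M0 : 0 < M := lt_le_trans ltr01 M1.
elim: k => [|k [IH1 IH2]]; first by rewrite addr0 expr0 mul1r.
have nk : n + k.+1%:Z = n + k%:Z + 1 by rewrite -(addn1 k) PoszD addrA.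
rewrite nk exprS -!mulrA; split.
  by apply: le_trans (gS _) _; rewrite ler_pM2l.
apply: le_trans IH2 _; rewrite mulrCA ler_wpM2l ?exprn_ge0 ?(ltW M0)//.
by have := gP (n + k%:Z + 1); rewrite addrK.
Qed.

(** A maximum on a segment farther than [N] from both ends would be a peak, and
    near an end the bounded ratios compare it with the value at that end. *)
Lemma peakless_ends g (n j : nat) : peakless g -> (j <= n)%N ->
  g j <= M ^+ N * Num.max (g 0) (g n).
Proof.
move=> gp jn; have [g0 gw _ _] := gp; have M0 : 0 < M := lt_le_trans ltr01 M1.
pose i := [arg max_(i > (ord0 : 'I_n.+1)) g (i : nat)]%O.
have iP (k : nat) : (k <= n)%N -> g k <= g (i : nat).
  rewrite -ltnS => kn; rewrite /i; case: Order.TotalTheory.arg_maxP => // i' _ imax.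
  exact: (imax (Ordinal kn) erefl).
have i_n : (i <= n)%N by rewrite -ltnS.
apply: le_trans (iP _ jn) _; clearbody i.
have MN k : (k <= N)%N -> M ^+ k <= M ^+ N by move=> kN; exact: ler_weXn2l.
have [iN|Ni] := leqP i N.
  have [+ _] := peakless_growth i gp 0; rewrite add0r => gi.
  apply: le_trans gi _; apply: ler_pM; rewrite ?exprn_ge0 ?(ltW M0) ?(ltW (g0 _)) ?MN//.
  by rewrite le_max lexx.
have [niN|Nni] := leqP (n - i) N.
  have [_ +] := peakless_growth (n - i) gp i; rewrite -PoszD subnKC// => gi.
  apply: le_trans gi _; apply: ler_pM; rewrite ?exprn_ge0 ?(ltW M0) ?(ltW (g0 _)) ?MN//.
  by rewrite le_max lexx orbT.
have [d dN gd] := gw i.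
have [k kE] : exists k : nat, i%:Z + d = k%:Z.
  by exists (absz (i%:Z + d)); lia.
have kn : (k <= n)%N by lia.
have := le_trans gd; rewrite kE => /(_ _ (iP _ kn)).
by have gi0 := g0 i; move: lam1; nra.
Qed.

(** Far from the start, each term is beaten by a neighbour that is itself
    bounded, so every window passed gains a factor. *)
Lemma peakless_decay g (S : R) : peakless g -> (forall n : nat, g n <= S) ->
  forall k n : nat, (k * N <= n)%N -> g n <= S / lam ^+ k.
Proof.
move=> [g0 gw _ _] gS; have l0 : 0 < lam := lt_trans ltr01 lam1.
elim=> [|k IH] n kn; first by rewrite expr0 divr1.
have [d dN gd] := gw n.
have [m mE] : exists m : nat, n%:Z + d = m%:Z.
  by exists (absz (n%:Z + d)); rewrite mulSn in kn; lia.
have kmn : (k * N <= m)%N by rewrite mulSn in kn; lia.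
rewrite exprSr invfM mulrA ler_pdivlMr// mulrC; apply: le_trans gd _.
by rewrite mE IH.
Qed.

(** Same decay with a constant governed by the initial term alone: the right
    end of a long segment is negligible in [peakless_ends]. *)
Lemma peakless_stable g (S : R) : peakless g -> (forall n : nat, g n <= S) ->
  forall k n : nat, (k * N <= n)%N -> g n <= M ^+ N * g 0 / lam ^+ k.
Proof.
move=> gp gS; have [g0 _ _ _] := gp; apply: peakless_decay => // j.
have [k kP] := geometric_small S lam1 (g0 0).
have gn : g (maxn j (k * N)) <= g 0.
  by apply: le_trans (ltW kP); apply: peakless_decay; rewrite ?leq_maxr.
have := @peakless_ends g (maxn j (k * N)) j gp (leq_maxl _ _).
by rewrite max_l.
Qed.

Lemma peakless_unbounded g (S : R) : peakless g -> ~ (forall n, g n <= S).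
Proof.
move=> [g0 gw _ _] gS; have l0 : 0 < lam := lt_trans ltr01 lam1.
have gk (k : nat) n : g n <= S / lam ^+ k.
  elim: k n => [|k IH] n; first by rewrite expr0 divr1.
  have [d _ gd] := gw n; rewrite exprSr invfM mulrA ler_pdivlMr// mulrC.
  exact: le_trans gd (IH _).
have [k] := geometric_small S lam1 (g0 0); apply/negP.
by rewrite -leNgt.
Qed.

End Sequences.
(** * Quasi-Anosov cocycles are hyperbolic *)

Section Hyperbolicity.
Variable R : realType.
Local Notation C := R[i].
Local Notation T := (C2 R).

Lemma normalize (v : T) : v != 0 ->
  exists k : C, hnorm (k *: v) = 1 /\ normc k = (hnorm v)^-1.
Proof.
move=> v0; exists ((hnorm v)^-1)%:C.
have kE : normc ((hnorm v)^-1)%:C = (hnorm v)^-1.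
  by rewrite normc_real ger0_norm// invr_ge0.
by rewrite hnormZ kE mulVf// hnorm_eq0.
Qed.

(** Killing the larger entry of the first row leaves a row of norm
    at most the modulus of the determinant. *)
Lemma small_image_aux (A : 'M[C]_2) (i j : 'I_2) : normc (\det A) <= 1 ->
  1 <= normc (A 0 i) -> i != j ->
  exists2 v : T, v 0 1 = 1 & hnorm (v *m A) <= 1.
Proof.
move=> dA Ai ij; have Ai0 : A 0 i != 0.
  by rewrite -normc_gt0 (lt_le_trans ltr01).
pose v : T := pt (- (A 1 i / A 0 i)) 1.
have v1 : v 0 1 = 1 by rewrite mxE.
exists v => //.
have vi : (v *m A) 0 i = 0 by rewrite mulmx2 !mxE /=; field.
have vj : normc ((v *m A) 0 j) * normc (A 0 i) = normc (\det A).
  rewrite -normcM mulmx2 !mxE /= det2.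
  case: (ord2P i) ij Ai0 => ->; case: (ord2P j) => -> //= _ A0.
    by congr normc; field.
  by rewrite -[RHS]normcN; congr normc; field.
have vj1 : normc ((v *m A) 0 j) <= 1.
  have := normc_ge0 ((v *m A) 0 j); nra.
apply: le_trans (hnorm_le_sum _) _.
by case: (ord2P i) ij vi vj1 => ->; case: (ord2P j) => -> //= _ -> v1';
  rewrite normc0 ?add0r ?addr0.
Qed.

Lemma small_image (A : 'M[C]_2) : normc (\det A) <= 1 ->
  exists2 v : T, hnorm v = 1 & hnorm (v *m A) <= 2.
Proof.
move=> dA; suff [v v0 vA] : exists2 v : T, v != 0 & hnorm (v *m A) <= 2 * hnorm v.
  have [k [kv kE]] := normalize v0; exists (k *: v) => //.
  by rewrite -scalemxAl hnormZ kE mulrC ler_pdivrMr ?hnorm_gt0.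
have big (i j : 'I_2) : i != j -> 1 <= normc (A 0 i) ->
    exists2 v : T, v != 0 & hnorm (v *m A) <= 2 * hnorm v.
  move=> ij Ai; have [v v1 vA] := small_image_aux dA Ai ij.
  have := ler_coord v 1; rewrite v1 normc1 => v1'.
  exists v; first by rewrite -hnorm_gt0 (lt_le_trans ltr01).
  by lra.
have [A0|/ltW A0] := leP (normc (A 0 0)) 1; last exact: (big 0 1).
have [A1|/ltW A1] := leP (normc (A 0 1)) 1; last exact: (big 1 0).
exists (pt 1 0).
  by apply/negP => /eqP/(congr1 (fun v : T => v 0 0)) /eqP; rewrite !mxE oner_eq0.
have -> : hnorm (pt 1 0 : T) = 1.
  by rewrite hnorm_pt normc1 normc0 expr1n expr0n /= addr0 sqrtr1.
apply: le_trans (hnorm_le_sum _) _; rewrite !mulmx2 !mxE /=.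
by rewrite !mul1r !mul0r !addr0; lra.
Qed.

(** One of the two coordinate vectors is far from a given line. *)
Lemma transverse (e : T) : hnorm e = 1 ->
  exists2 v : T, hnorm v = 1 & 2^-1 <= normc (wedge v e).
Proof.
move=> e1; have := hnorm_le_sum e; rewrite e1 => es.
have p10 : hnorm (pt 1 0 : T) = 1.
  by rewrite hnorm_pt normc1 normc0 expr1n expr0n /= addr0 sqrtr1.
have p01 : hnorm (pt 0 1 : T) = 1.
  by rewrite hnorm_pt normc1 normc0 expr1n expr0n /= add0r sqrtr1.
have wE x y : wedge (pt x y) e = x * e 0 1 - y * e 0 0.
  by rewrite /wedge !mxE.
have [e0|e0] := leP (2^-1) (normc (e 0 1)).
  by exists (pt 1 0) => //; rewrite wE mul1r mul0r subr0.
exists (pt 0 1) => //; rewrite wE mul1r mul0r add0r normcN; lra.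
Qed.

Lemma mulmx_continuous (X : topologicalType) (u : X -> T) (A : X -> 'M[C]_2) :
  continuous u -> (forall i j, continuous (fun p => A p i j)) ->
  continuous (fun p => u p *m A p).
Proof.
move=> uc Ac.
have ucj j : continuous (fun p => u p 0 j).
  exact: (continuous_compo uc (@coordE_continuous R j)).
have c j : continuous (fun p => (u p *m A p) 0 j).
  rewrite (_ : (fun p => _) = fun p => u p 0 0 * A p 0 j + u p 0 1 * A p 1 j).
    by apply: continuous_addc; apply: continuous_mulc.
  by apply/funext => p; rewrite mulmx2.
exact: row2_continuous.
Qed.

Lemma closed_forall (X : topologicalType) (I : Type) (D : set I)
    (P : I -> set X) :
  (forall i, closed (P i)) -> closed [set x | forall i, D i -> P i x].
Proof. by move=> Pc; apply: closed_bigI. Qed.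

Variables (J : set T) (F : int -> T -> T) (B : int -> T -> 'M[C]_2).
Hypotheses (Jcompact : compact J) (FJ : forall n x, J x -> J (F n x)).
Hypotheses (F0 : forall x, F 0 x = x)
  (FD : forall m n x, F (m + n) x = F m (F n x)).
Hypotheses (B0 : forall x, B 0 x = 1%:M)
  (BD : forall m n x, B (m + n) x = B n x *m B m (F n x)).
Hypothesis Bcontinuous : forall n i j, continuous (fun x => B n x i j).
Hypothesis Bdet : forall (n : nat) x, normc (\det (B n x)) <= 1.

Lemma BDv (m n : int) x (v : T) : v *m B (m + n) x = v *m B n x *m B m (F n x).
Proof. by rewrite BD mulmxA. Qed.

Lemma cocycleK (n : int) x (v : T) : v *m B n x *m B (- n) (F n x) = v.
Proof. by rewrite -BDv addNr B0 mulmx1. Qed.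

Lemma cocycleVK (n : int) x (v : T) : v *m B (- n) (F n x) *m B n x = v.
Proof.
have := cocycleK (- n) (F n x) v.
by rewrite -FD addNr F0 opprK.
Qed.

Lemma cocycle_neq0 (n : int) x (v : T) : v != 0 -> v *m B n x != 0.
Proof.
by apply: contra_neq => vB; rewrite -(cocycleK n x v) vB mul0mx.
Qed.

Lemma cocycle_bound (n : int) :
  exists2 M : R, 1 <= M & forall x (v : T), J x ->
    hnorm (v *m B n x) <= M * hnorm v.
Proof.
have [M MP] := compact_upper_bound Jcompact (entries_continuous (@Bcontinuous n)).
exists (Num.max 1 (4 * M)) => [|x v Jx]; first by rewrite le_max lexx.
apply: le_trans (ler_entries _ _) _; apply: ler_wpM2r => //.
by rewrite le_max ler_pM2l ?MP ?orbT.
Qed.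

Lemma cocycle_step :
  exists2 M : R, 1 <= M & forall x (v : T), J x ->
    hnorm (v *m B 1 x) <= M * hnorm v /\ hnorm (v *m B (-1) x) <= M * hnorm v.
Proof.
have [M M1 MP] := cocycle_bound 1; have [M' M1' MP'] := cocycle_bound (-1).
exists (M + M') => [|x v Jx]; first by lra.
have v0 := hnorm_ge0 v; split.
  by apply: le_trans (MP _ v Jx) _; rewrite ler_wpM2r// lerDl (le_trans ler01).
by apply: le_trans (MP' _ v Jx) _; rewrite ler_wpM2r// lerDr (le_trans ler01).
Qed.

Lemma snd_cocycle_continuous (n : int) :
  continuous (fun p : T * T => p.2 *m B n p.1).
Proof.
apply: mulmx_continuous => [p|i j]; first exact: cvg_snd.
apply: (@continuous_compo (T * T)%type T C fst) (@Bcontinuous n i j).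
by move=> p; exact: cvg_fst.
Qed.

Hypothesis no_peak : forall x (v : T), J x -> v != 0 ->
  exists n, hnorm v < hnorm (v *m B n x).

(** By compactness, the orbit beats each vector by a definite factor within a
    bounded time. *)
Lemma uniform_no_peak : exists2 lam : R, 1 < lam &
  exists N : nat, forall x (v : T), J x -> v != 0 ->
    exists2 n : int, (`|n| <= N)%N & lam * hnorm v <= hnorm (v *m B n x).
Proof.
apply: contrapT => noN.
pose l (k : nat) : R := 1 + k.+1%:R^-1.
have l1 k : 1 < l k by rewrite ltrDl invr_gt0.
pose W k := [set p : T * T | 1 <= hnorm p.2] `&`
  [set p : T * T | forall n : int, (`|n| <= k)%N -> hnorm (p.2 *m B n p.1) <= l k].
have Kc := compact_setX Jcompact (@compact_hball R 1).
have sndc : continuous (snd : T * T -> T) by move=> p; exact: cvg_snd.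
have Wc k : closed (W k).
  apply: closedI.
    by apply: hclosed_le; [exact: cst_continuous|exact: hnorm_compo_continuous].
  apply: (@closed_forall _ int [set n | (`|n| <= k)%N]
    (fun n => [set p : T * T | hnorm (p.2 *m B n p.1) <= l k])) => n.
  apply: hclosed_le; last exact: cst_continuous.
  exact: (hnorm_compo_continuous (@snd_cocycle_continuous n)).
have Wd i k : (i <= k)%N -> W k `<=` W i.
  move=> ik p [/= p1 pk]; split=> //= n ni.
  apply: le_trans (pk _ (leq_trans ni ik)) _.
  by rewrite lerD2l lef_pV2 ?posrE// ler_nat ltnS.
have [k|[x v] [/= Jx v1] Wxv] := compact_decreasing Kc Wc Wd.
  apply: contrapT => nW; apply: noN; exists (l k) => //; exists k => x v Jx v0.
  apply: contrapT => nn; apply: nW.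
  have [c [cv cE]] := normalize v0.
  exists (x, c *: v); split=> //=; rewrite ?cv// => n nk.
  rewrite -scalemxAl hnormZ cE mulrC ler_pdivrMr ?hnorm_gt0// leNgt.
  by apply/negP => /ltW lv; apply: nn; exists n.
have [v1' _] := Wxv 0%N; rewrite /= in v1'.
have v0 : v != 0 by rewrite -hnorm_gt0 (lt_le_trans ltr01).
have [n nv] := no_peak Jx v0.
pose e := hnorm (v *m B n x) - 1.
have e0 : 0 < e by rewrite subr_gt0 (le_lt_trans v1').
pose k := maxn `|n| (Num.truncn e^-1).
have [_ /(_ n (leq_maxl _ _))] := Wxv k; apply/negP; rewrite -ltNge /=.
rewrite /l -ltrBrDl -/e invf_plt ?posrE//.
have /truncn_itv/andP[_ ek] : 0 <= e^-1 by rewrite invr_ge0 ltW.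
by apply: lt_le_trans ek _; rewrite ler_nat ltnS leq_maxr.
Qed.

Hypothesis no_sink : forall x, J x -> forall n : nat,
  ~ (forall (m : nat) (v : T), hnorm (v *m B n (F m x)) <= 2^-1 * hnorm v).

Definition forward_bounded x (v : T) :=
  exists S : R, forall n : nat, hnorm (v *m B n x) <= S.
Definition backward_bounded x (v : T) :=
  exists S : R, forall n : nat, hnorm (v *m B (- n%:Z) x) <= S.

Section Constants.
Variables (M lam : R) (N : nat).
Hypotheses (M1 : 1 <= M) (lam1 : 1 < lam).
Hypothesis step : forall x (v : T), J x ->
  hnorm (v *m B 1 x) <= M * hnorm v /\ hnorm (v *m B (-1) x) <= M * hnorm v.
Hypothesis window : forall x (v : T), J x -> v != 0 ->
  exists2 n : int, (`|n| <= N)%N & lam * hnorm v <= hnorm (v *m B n x).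

Let K := M ^+ N * 2.

Lemma MN_gt0 : 0 < M ^+ N. Proof. by rewrite exprn_gt0// (lt_le_trans ltr01). Qed.

Lemma orbit_peakless x (v : T) : J x -> v != 0 ->
  peakless M lam N (fun n => hnorm (v *m B n x)).
Proof.
move=> Jx v0; split=> n.
- by rewrite hnorm_gt0 cocycle_neq0.
- have [j jN vj] := window (FJ n Jx) (cocycle_neq0 n x v0).
  exists j; first exact: jN.
  by rewrite [n + j]addrC BDv.
- by rewrite addrC BDv; have [] := step (v *m B n x) (FJ n Jx).
- by rewrite addrC BDv; have [] := step (v *m B n x) (FJ n Jx).
Qed.

Lemma forward_decay x (v : T) : J x -> forward_bounded x v ->
  forall k n : nat, (k * N <= n)%N ->
    hnorm (v *m B n x) <= M ^+ N * hnorm v / lam ^+ k.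
Proof.
move=> Jx [S vS] k n kn; have [->|v0] := eqVneq v 0.
  by rewrite mul0mx hnorm0 mulr0 mul0r.
have := peakless_stable M1 lam1 (orbit_peakless Jx v0) vS kn.
by rewrite B0 mulmx1.
Qed.

Lemma backward_decay x (v : T) : J x -> backward_bounded x v ->
  forall k n : nat, (k * N <= n)%N ->
    hnorm (v *m B (- n%:Z) x) <= M ^+ N * hnorm v / lam ^+ k.
Proof.
move=> Jx [S vS] k n kn; have [->|v0] := eqVneq v 0.
  by rewrite mul0mx hnorm0 mulr0 mul0r.
have := peakless_stable M1 lam1 (peakless_opp (orbit_peakless Jx v0)) vS kn.
by rewrite /= oppr0 B0 mulmx1.
Qed.

Lemma not_bibounded x (v : T) : J x -> v != 0 ->
  forward_bounded x v -> backward_bounded x v -> False.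
Proof.
move=> Jx v0 [S vS] [S' vS'].
apply: (@peakless_unbounded _ _ _ _ lam1 _ (Num.max S S') (orbit_peakless Jx v0)).
by case=> n; rewrite le_max ?vS// NegzE vS' orbT.
Qed.

Lemma forward_bounded_span x (v w : T) : wedge v w != 0 ->
  forward_bounded x v -> forward_bounded x w -> forall u, forward_bounded x u.
Proof.
move=> vw [S vS] [S' wS] u.
exists ((normc (wedge u w) * S + normc (wedge v u) * S') / normc (wedge v w)) => n.
rewrite ler_pdivlMr ?normc_gt0// mulrC -hnormZ scalemxAl wedge_cramer mulmxDl.
apply: le_trans (ler_hnormD _ _) _; rewrite -!scalemxAl !hnormZ.
by apply: lerD; apply: ler_wpM2l.
Qed.

Lemma backward_bounded_span x (v w : T) : wedge v w != 0 ->
  backward_bounded x v -> backward_bounded x w -> forall u, backward_bounded x u.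
Proof.
move=> vw [S vS] [S' wS] u.
exists ((normc (wedge u w) * S + normc (wedge v u) * S') / normc (wedge v w)) => n.
rewrite ler_pdivlMr ?normc_gt0// mulrC -hnormZ scalemxAl wedge_cramer mulmxDl.
apply: le_trans (ler_hnormD _ _) _; rewrite -!scalemxAl !hnormZ.
by apply: lerD; apply: ler_wpM2l.
Qed.

(** A plane of forward bounded vectors would contract uniformly along the whole
    forward orbit, which is what the absence of sinks forbids. *)
Lemma stable_line x (v w : T) : J x ->
  forward_bounded x v -> forward_bounded x w -> wedge v w = 0.
Proof.
move=> Jx vb wb; apply/eqP/negPn/negP => vw.
have half : 0 < 2^-1 :> R by rewrite invr_gt0.
have [k kP] := geometric_small (M ^+ N) lam1 half.
apply: (no_sink Jx (n := (k * N)%N)) => m u.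
have ub : forward_bounded (F m x) u.
  have [S uS] := forward_bounded_span vw vb wb (u *m B (- m%:Z) (F m x)).
  exists S => n; have := uS (n + m)%N.
  by rewrite PoszD BDv cocycleVK.
apply: le_trans (forward_decay (FJ m Jx) ub (leqnn _)) _.
by rewrite mulrAC ler_wpM2r// ltW.
Qed.

Lemma orbit_ends x (v : T) (n j : nat) : J x -> v != 0 -> (j <= n)%N ->
  hnorm (v *m B j x) <= M ^+ N * Num.max (hnorm v) (hnorm (v *m B n x)).
Proof.
move=> Jx v0 jn; have := peakless_ends M1 lam1 (orbit_peakless Jx v0) jn.
by rewrite B0 mulmx1.
Qed.

Lemma unit_neq0 (v : T) : hnorm v = 1 -> v != 0.
Proof. by move=> v1; rewrite -hnorm_gt0 v1. Qed.

Lemma vec_cocycle_continuous (n : int) x : continuous (fun v : T => v *m B n x).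
Proof.
apply: mulmx_continuous => [v|i j]; [exact: cvg_id|exact: cst_continuous].
Qed.

(** The times [s j] stand for the forward or the backward orbit; the compactness
    of the unit sphere turns finite-time bounds into a bound for all times. *)
Lemma unit_orbit_limit (s : nat -> int) x :
  (forall n : nat, exists2 v : T, hnorm v = 1 &
     forall j : nat, (j <= n)%N -> hnorm (v *m B (s j) x) <= K) ->
  exists2 v : T, v != 0 & forall j : nat, hnorm (v *m B (s j) x) <= K.
Proof.
move=> vn.
pose W n := [set v : T | 1 <= hnorm v] `&`
  [set v : T | forall j : nat, (j <= n)%N -> hnorm (v *m B (s j) x) <= K].
have Wc n : closed (W n).
  apply: closedI.
    by apply: hclosed_le; [exact: cst_continuous|exact: hnorm_continuous].
  apply: (@closed_forall _ nat [set j | (j <= n)%N]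
    (fun j => [set v : T | hnorm (v *m B (s j) x) <= K])) => j.
  apply: hclosed_le; last exact: cst_continuous.
  exact: (hnorm_compo_continuous (@vec_cocycle_continuous (s j) x)).
have Wd m n : (m <= n)%N -> W n `<=` W m.
  by move=> mn v [v1 vP]; split=> // j jm; apply: vP; exact: leq_trans mn.
have [n|v _ vP] := compact_decreasing (@compact_hball R 1) Wc Wd.
  have [v v1 vP] := vn n; exists v; first by rewrite /= v1.
  by split=> //=; rewrite v1.
exists v => [|j]; last by have [_] := vP j; exact.
by have [v1 _] := vP 0%N; rewrite -hnorm_gt0 (lt_le_trans ltr01).
Qed.

(** As determinants are at most one, each [B n x] expands some unit vector
    by at most a factor two, and its intermediate images are then controlled by both ends. *)
Lemma stable_exists x : J x -> exists2 v : T, v != 0 & forward_bounded x v.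
Proof.
move=> Jx; have [n|v v0 vK] := @unit_orbit_limit Posz x; last by exists v => //; exists K.
have [v v1 vn] := small_image (Bdet n x); exists v => // j jn.
apply: le_trans (orbit_ends Jx (unit_neq0 v1) jn) _.
by rewrite ler_pM2l ?MN_gt0// v1 ge_max vn andbT; lra.
Qed.

(** A vector transverse to the stable line must leave any bounded region within
    a uniform time: otherwise the limit would be a plane of bounded vectors. *)
Lemma transverse_escape : exists n0 : nat, forall x (v e : T), J x ->
  hnorm v = 1 -> hnorm e = 1 -> 2^-1 <= normc (wedge v e) ->
  (forall n : nat, hnorm (e *m B n x) <= K) ->
  exists2 j : nat, (j <= n0)%N & K < hnorm (v *m B j x).
Proof.
apply: contrapT => non.
pose W n := [set p : (T * T) * T | 2^-1 <= normc (wedge p.1.2 p.2)] `&`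
  ([set p : (T * T) * T | forall j : nat, (j <= n)%N ->
     hnorm (p.1.2 *m B j p.1.1) <= K] `&`
   [set p : (T * T) * T | forall j : nat, (j <= n)%N ->
     hnorm (p.2 *m B j p.1.1) <= K]).
have Kc := compact_setX (compact_setX Jcompact (@compact_hball R 1))
  (@compact_hball R 1).
have c1 : continuous (fst : (T * T) * T -> T * T) by move=> p; exact: cvg_fst.
have c2 : continuous (snd : (T * T) * T -> T) by move=> p; exact: cvg_snd.
have c11 : continuous (fun p : (T * T) * T => p.1.1).
  by apply: (@continuous_compo _ (T * T)%type T fst fst) => // p; exact: cvg_fst.
have c12 : continuous (fun p : (T * T) * T => p.1.2).
  by apply: (@continuous_compo _ (T * T)%type T fst snd) => // p; exact: cvg_snd.
have cB (n : nat) i j : continuous (fun p : (T * T) * T => B n p.1.1 i j).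
  exact: (@continuous_compo _ T C (fun p : (T * T) * T => p.1.1) _ c11
    (@Bcontinuous n i j)).
have Wc n : closed (W n).
  apply: closedI; last apply: closedI.
  - apply: hclosed_le; first exact: cst_continuous.
    apply: normc_compo_continuous.
    have cc (u : (T * T) * T -> T) j : continuous u -> continuous (fun p => u p 0 j).
      by move=> uc; exact: (continuous_compo uc (@coordE_continuous R j)).
    rewrite /wedge => p; apply: cvgB.
      by apply: cvgM; [exact: (cc _ 0 c12)|exact: (cc _ 1 c2)].
    by apply: cvgM; [exact: (cc _ 1 c12)|exact: (cc _ 0 c2)].
  - apply: (@closed_forall _ nat [set j | (j <= n)%N]
      (fun j => [set p : (T * T) * T | hnorm (p.1.2 *m B j p.1.1) <= K])) => j.
    apply: hclosed_le; last exact: cst_continuous.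
    exact: (hnorm_compo_continuous (mulmx_continuous c12 (cB j))).
  - apply: (@closed_forall _ nat [set j | (j <= n)%N]
      (fun j => [set p : (T * T) * T | hnorm (p.2 *m B j p.1.1) <= K])) => j.
    apply: hclosed_le; last exact: cst_continuous.
    exact: (hnorm_compo_continuous (mulmx_continuous c2 (cB j))).
have Wd m n : (m <= n)%N -> W n `<=` W m.
  move=> mn p [pw [pv pe]]; split=> //; split=> j jm.
    by apply: pv; exact: leq_trans mn.
  by apply: pe; exact: leq_trans mn.
have [n|[[x v] e] [[/= Jx _] _] Wp] := compact_decreasing Kc Wc Wd.
  apply: contrapT => nW; apply: non; exists n => x v e Jx v1 e1 ve eK.
  apply: contrapT => nj; apply: nW; exists (x, v, e); rewrite /= ?v1 ?e1//.
  split=> //; split=> //= j jn; rewrite leNgt; apply/negP => vK.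
  by apply: nj; exists j.
have vb : forward_bounded x v.
  by exists K => n; have [_ [/= vK _]] := Wp n; exact: vK.
have eb : forward_bounded x e.
  by exists K => n; have [_ [_ /= eK]] := Wp n; exact: eK.
have [/= + _] := Wp 0%N; rewrite (stable_line Jx vb eb) normc0; lra.
Qed.

(** The image at [x] of a vector transverse to the stable line far in the past:
    it has not shrunk, so it controls its own backward orbit. *)
Lemma unstable_exists x : J x -> exists2 w : T, w != 0 & backward_bounded x w.
Proof.
move=> Jx; have [n0 n0P] := transverse_escape.
have [n|v v0 vK] := @unit_orbit_limit (fun j => - j%:Z) x;
  last by exists v => //; exists K.
pose n' := maxn n n0; pose y := F (- n'%:Z) x.
have Jy : J y by exact: FJ.
have yx : F n' y = x by rewrite -FD subrr F0.
have [e0 e00 e0b] := stable_exists Jy.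
have [c [e1 _]] := normalize e00; set e := c *: e0 in e1.
have eK (k : nat) : hnorm (e *m B k y) <= K.
  have eb : forward_bounded y e.
    have [S eS] := e0b; exists (normc c * S) => m.
    by rewrite -scalemxAl hnormZ ler_wpM2l.
  apply: le_trans (@forward_decay y e Jy eb 0 k (leq0n k)) _.
  by rewrite e1 expr0 divr1 mulr1 /K ler_peMr ?(ltW MN_gt0)//; lra.
have [v v1 ve] := transverse e1.
have [j jn0 vj] := n0P y v e Jy v1 e1 ve eK.
have v0 := unit_neq0 v1.
pose w := v *m B n' y.
have w0 : w != 0 by exact: cocycle_neq0.
have w1 : 1 <= hnorm w.
  rewrite leNgt; apply/negP => w1; move: vj; apply/negP; rewrite -leNgt.
  have jn' : (j <= n')%N by rewrite (leq_trans jn0)// leq_maxr.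
  apply: le_trans (orbit_ends Jy v0 jn') _.
  by rewrite ler_pM2l ?MN_gt0// ge_max v1 (le_trans (ltW w1)) ?ler1n.
have [d [dw dE]] := normalize w0.
exists (d *: w) => // i i_n; rewrite -scalemxAl hnormZ dE mulrC.
rewrite ler_pdivrMr ?hnorm_gt0//.
have i_n' : (i <= n')%N by rewrite (leq_trans i_n)// leq_maxl.
have -> : w *m B (- i%:Z) x = v *m B (n' - i)%N y.
  by rewrite -subzn// addrC BDv yx.
apply: le_trans (orbit_ends Jy v0 (leq_subr i n')) _.
rewrite v1 max_r// /K -mulrA ler_pM2l ?MN_gt0//.
by rewrite ler_peMl ?hnorm_ge0 ?ler1n.
Qed.

Lemma stable_shift x (v : T) : J x -> forward_bounded x v ->
  forward_bounded (F 1 x) (v *m B 1 x).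
Proof.
move=> Jx [S vS]; exists S => n.
by rewrite -BDv -PoszD addn1.
Qed.

Lemma unstable_shift x (w : T) : J x -> backward_bounded x w ->
  backward_bounded (F 1 x) (w *m B 1 x).
Proof.
move=> Jx [S wS]; exists (Num.max S (hnorm (w *m B 1 x))) => n.
rewrite -BDv; case: n => [|n].
  by rewrite oppr0 add0r le_max lexx orbT.
by rewrite -(addn1 n) PoszD opprD subrK le_max wS.
Qed.

Lemma constants_splitting : exists v w : T -> T,
  [/\ forall x, J x -> wedge (v x) (w x) != 0,
      forall x, J x -> wedge (v x *m B 1 x) (v (F 1 x)) = 0 /\
                       wedge (w x *m B 1 x) (w (F 1 x)) = 0 &
      forall e : R, 0 < e -> exists2 l : nat, (1 <= l)%N & forall x, J x ->
        hnorm (v x *m B l x) <= e * hnorm (v x) /\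
        hnorm (w x *m B (- l%:Z) x) <= e * hnorm (w x)].
Proof.
have /choice[v vP] : forall x, exists v, J x -> v != 0 /\ forward_bounded x v.
  move=> x; have [Jx|nJ] := pselect (J x); last by exists 0.
  by have [v] := stable_exists Jx; exists v.
have /choice[w wP] : forall x, exists w, J x -> w != 0 /\ backward_bounded x w.
  move=> x; have [Jx|nJ] := pselect (J x); last by exists 0.
  by have [u] := unstable_exists Jx; exists u.
exists v, w; split.
- move=> x Jx; have [v0 vb] := vP x Jx; have [w0 wb] := wP x Jx.
  apply/negP => /eqP /(wedge_eq0 v0)[k wE].
  apply: (not_bibounded Jx w0 _ wb); have [S vS] := vb.
  exists (normc k * S) => n; rewrite wE -scalemxAl hnormZ.
  exact: ler_wpM2l.
- move=> x Jx; have Jfx := FJ 1 Jx; have [v0 vb] := vP x Jx; have [w0 wb] := wP x Jx.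
  have [v0' vb'] := vP _ Jfx; have [w0' wb'] := wP _ Jfx.
  split; first exact: (stable_line Jfx (stable_shift Jx vb) vb').
  apply/eqP/negPn/negP => ww; apply: (not_bibounded Jfx v0' vb').
  exact: (backward_bounded_span ww (unstable_shift Jx wb) wb').
- move=> e e0; have [k kP] := geometric_small (M ^+ N) lam1 e0.
  exists (k * N).+1 => // x Jx; have [_ vb] := vP x Jx; have [_ wb] := wP x Jx.
  split.
    apply: le_trans (forward_decay Jx vb (leqnSn _)) _.
    by rewrite mulrAC ler_wpM2r// ltW.
  apply: le_trans (backward_decay Jx wb (leqnSn _)) _.
  by rewrite mulrAC ler_wpM2r// ltW.
Qed.

End Constants.

(** A cocycle with determinants at most one and without norm-maximal vectors is
    hyperbolic as soon as it does not contract a whole plane. *)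
Theorem quasi_Anosov_splitting : exists v w : T -> T,
  [/\ forall x, J x -> wedge (v x) (w x) != 0,
      forall x, J x -> wedge (v x *m B 1 x) (v (F 1 x)) = 0 /\
                       wedge (w x *m B 1 x) (w (F 1 x)) = 0 &
      forall e : R, 0 < e -> exists2 l : nat, (1 <= l)%N & forall x, J x ->
        hnorm (v x *m B l x) <= e * hnorm (v x) /\
        hnorm (w x *m B (- l%:Z) x) <= e * hnorm (w x)].
Proof.
have [lam lam1 [N window]] := uniform_no_peak.
have [M M1 step] := cocycle_step.
exact: constants_splitting M1 lam1 step window.
Qed.

End Hyperbolicity.
(** * Spherical derivative and operator norm on lines *)

Section Projective.
Variable R : realType.
Local Notation C := R[i].
Local Notation T := (C2 R).
Implicit Types (u v w : T) (A : 'M[C]_2).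

Lemma vpick_line w : w != 0 ->
  exists2 k : C, k != 0 & vpick <[w]>%VS = k *: w.
Proof.
move=> w0; have /vlineP[k kE] := memv_pick <[w]>%VS; exists k => //.
have : vpick <[w]>%VS != 0.
  by rewrite vpick0 -dimv_eq0 dim_vline w0.
by apply: contra_neq => k0; rewrite kE k0 scale0r.
Qed.

Lemma line_of_dim1 (U : {vspace T}) : \dim U = 1%N ->
  exists2 u, u != 0 & U = <[u]>%VS.
Proof.
move=> dU; have u0 : vpick U != 0 by rewrite vpick0 -dimv_eq0 dU.
exists (vpick U) => //; apply/eqP.
by rewrite eq_sym eqEdim dU dim_vline u0 andbT -memvE memv_pick.
Qed.

Lemma chart_line (c : 'I_2) w : w != 0 ->
  chart c <[w]>%VS = w 0 (rev_ord c) / w 0 c.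
Proof.
move=> w0; have [k k0 kE] := vpick_line w0.
by rewrite /chart kE !mxE invfM mulrACA divff// mul1r.
Qed.

Lemma chart_at_line w : w != 0 -> w 0 (chart_at <[w]>%VS) != 0.
Proof.
move=> w0; have [k k0 kE] := vpick_line w0; rewrite /chart_at kE !mxE.
rewrite mulf_eq0 (negbTE k0) /=; case: ifP => // /negbFE/eqP w1.
by apply: contra_neq w0 => w00; apply: row2P; rewrite mxE.
Qed.

Lemma derive1_mobius (a c d e : C) (t : C) : d + t * e != 0 ->
  derive1 (fun s : C => (a + s * c) / (d + s * e)) t =
  (c * d - a * e) / (d + t * e) ^+ 2.
Proof.
move=> de0; rewrite /derive1.
have -> : (c * d - a * e) / (d + t * e) ^+ 2 =
  (c * d - a * e) * ((d + t * e) * (d + (0 + t) * e))^-1.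
  by rewrite add0r expr2.
apply: cvg_lim; first exact: norm_hausdorff.
pose D (h : C) := (d + t * e) * (d + (h + t) * e).
have Dc : continuous D.
  apply: continuous_mulc; first exact: cst_continuous.
  apply: continuous_addc; first exact: cst_continuous.
  apply: continuous_mulc; last exact: cst_continuous.
  by apply: continuous_addc; [move=> ?; exact: cvg_id|exact: cst_continuous].
have D0 : D 0 != 0 by rewrite /D add0r mulf_neq0.
have Vc : (fun h => (c * d - a * e) * (D h)^-1) @ (0 : C) --> (c * d - a * e) * (D 0)^-1.
  exact: (cvgM (cvg_cst (c * d - a * e)) (cvgV D0 (Dc 0))).
have Dn : nbhs (0 : C) [set h | D h != 0].
  apply: (Dc 0 [set z | z != 0]); apply/nbhs_normcP.
  exists (normc (D 0)); first by rewrite normc_gt0.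
  move=> z /= zD; apply/eqP => z0; move: zD.
  by rewrite z0 sub0r normcN ltxx.
move=> P lP; have VP : nbhs (0 : C) [set h | P ((c * d - a * e) * (D h)^-1)].
  exact: Vc.
suff : nbhs (0 : C) [set h | h != 0 -> P (h^-1 *: ((a + (h + t) * c) /
    (d + (h + t) * e) - (a + t * c) / (d + t * e)))] by [].
apply: filterS (filterI VP Dn) => h /= [Ph Dh] h0.
rewrite [X in P X](_ : _ = (c * d - a * e) * (D h)^-1)//.
rewrite -[_ *: _]/(_ * _).
have de0' : d + (h + t) * e != 0.
  by apply: contra_neq Dh => dh; rewrite /D dh mulr0.
by rewrite /D; field; rewrite h0 de0' de0.
Qed.

(** The vector spanning the line [chart_inv c s]. *)
Definition chart_vec (c : 'I_2) (s : C) : T := \row_j (if j == c then 1 else s).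

Lemma chart_vecE (c : 'I_2) (s : C) :
  chart_vec c s 0 c = 1 /\ chart_vec c s 0 (rev_ord c) = s.
Proof.
have r0 : rev_ord (0 : 'I_2) = 1 by exact: val_inj.
have r1 : rev_ord (1 : 'I_2) = 0 by exact: val_inj.
by rewrite !mxE eqxx; case: (ord2P c) => ->; rewrite ?r0 ?r1.
Qed.

Lemma chart_vec_neq0 c s : chart_vec c s != 0.
Proof.
apply/negP => /eqP v0; have [] := chart_vecE c s.
by rewrite v0 mxE => /eqP; rewrite eq_sym oner_eq0.
Qed.

Lemma sqr_hnorm_chart (c : 'I_2) v :
  hnorm v ^+ 2 = normc (v 0 c) ^+ 2 + normc (v 0 (rev_ord c)) ^+ 2.
Proof.
have r0 : rev_ord (0 : 'I_2) = 1 by exact: val_inj.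
have r1 : rev_ord (1 : 'I_2) = 0 by exact: val_inj.
by rewrite sqr_hnorm; case: (ord2P c) => ->; rewrite ?r0 ?r1// addrC.
Qed.

Lemma mulmx_chart (c : 'I_2) v A j :
  (v *m A) 0 j = v 0 c * A c j + v 0 (rev_ord c) * A (rev_ord c) j.
Proof.
have r0 : rev_ord (0 : 'I_2) = 1 by exact: val_inj.
have r1 : rev_ord (1 : 'I_2) = 0 by exact: val_inj.
by rewrite mulmx2; case: (ord2P c) => ->; rewrite ?r0 ?r1// addrC.
Qed.

Lemma det_chart (c d : 'I_2) A :
  normc (A (rev_ord c) (rev_ord d) * A c d - A c (rev_ord d) * A (rev_ord c) d) =
  normc (\det A).
Proof.
have r0 : rev_ord (0 : 'I_2) = 1 by exact: val_inj.
have r1 : rev_ord (1 : 'I_2) = 0 by exact: val_inj.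
rewrite det2; case: (ord2P c) => ->; case: (ord2P d) => ->; rewrite ?r0 ?r1.
- by congr normc; ring.
- by rewrite -normcN; congr normc; ring.
- by rewrite -normcN; congr normc; ring.
- by congr normc; ring.
Qed.

(** In homogeneous coordinates the spherical derivative of a Mobius map is the
    determinant over the square of the dilation of the underlying vector. *)
Lemma sph_deriv_line A (G : {vspace T} -> {vspace T}) u :
  (forall w, G <[w]>%VS = <[w *m A]>%VS) -> \det A != 0 -> u != 0 ->
  sph_deriv G <[u]>%VS = normc (\det A) * hnorm u ^+ 2 / hnorm (u *m A) ^+ 2.
Proof.
move=> GA dA u0; rewrite /sph_deriv.
set c := chart_at <[u]>%VS; set d := chart_at (G <[u]>%VS).
have Ainj w : w != 0 -> w *m A != 0.
  have Au : A \in unitmx by rewrite unitmxE unitfE.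
  by apply: contra_neq => wA; rewrite -(mulmxK Au w) wA mul0mx.
have uc : u 0 c != 0 by exact: chart_at_line.
have uAd : (u *m A) 0 d != 0 by rewrite /d GA; apply: chart_at_line; exact: Ainj.
rewrite chart_line//; set t := u 0 (rev_ord c) / u 0 c.
have gE : (fun s => chart d (G (chart_inv c s))) = fun s =>
    (A c (rev_ord d) + s * A (rev_ord c) (rev_ord d)) /
    (A c d + s * A (rev_ord c) d).
  apply/funext => s; rewrite -[chart_inv c s]/(<[chart_vec c s]>%VS) GA.
  rewrite chart_line ?Ainj ?chart_vec_neq0// !(mulmx_chart c).
  by have [-> ->] := chart_vecE c s; rewrite !mul1r.
rewrite gE; pose e := chart_vec c t.
have ue : u = u 0 c *: e.
  have [ec er] := chart_vecE c t.
  have r0 : rev_ord (0 : 'I_2) = 1 by exact: val_inj.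
  have r1 : rev_ord (1 : 'I_2) = 0 by exact: val_inj.
  have uer : u 0 (rev_ord c) = u 0 c * e 0 (rev_ord c) by rewrite er /t mulrC divfK.
  have uec : u 0 c = u 0 c * e 0 c by rewrite ec mulr1.
  apply: row2P; rewrite mxE; move: uec uer; case: (ord2P c) => ->;
    rewrite ?r0 ?r1 //.
have eAj j : (e *m A) 0 j = A c j + t * A (rev_ord c) j.
  by rewrite (mulmx_chart c); have [-> ->] := chart_vecE c t; rewrite mul1r.
have eAd : (e *m A) 0 d != 0.
  by apply: contra_neq uAd => eA; rewrite ue -scalemxAl mxE eA mulr0.
rewrite derive1_mobius -?eAj//.
rewrite !normcM !normcV normcX det_chart /sph_density.
have e2 : 1 + normc t ^+ 2 = hnorm e ^+ 2.
  by rewrite (sqr_hnorm_chart c); have [-> ->] := chart_vecE c t; rewrite normc1 expr1n.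
have eA2 := sqr_hnorm_chart d (e *m A).
have hu : hnorm u = normc (u 0 c) * hnorm e by rewrite {1}ue hnormZ.
have huA : hnorm (u *m A) = normc (u 0 c) * hnorm (e *m A).
  by rewrite {1}ue -scalemxAl hnormZ.
rewrite e2 hu huA.
have E0 : hnorm e != 0 by rewrite hnorm_eq0 chart_vec_neq0.
have EA0 : hnorm (e *m A) != 0 by rewrite hnorm_eq0 Ainj ?chart_vec_neq0.
have k0 : normc (u 0 c) != 0 by rewrite normc_eq0.
have D0 : normc ((e *m A) 0 d) != 0 by rewrite normc_eq0.
have S0 : 1 + (normc ((e *m A) 0 (rev_ord d)) / normc ((e *m A) 0 d)) ^+ 2 =
   hnorm (e *m A) ^+ 2 / normc ((e *m A) 0 d) ^+ 2.
  by rewrite eA2; field.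
have gt : chart d (G (chart_inv c t)) = (e *m A) 0 (rev_ord d) / (e *m A) 0 d.
  by rewrite !eAj -(congr1 (fun g => g t) gE).
rewrite gt normcM normcV S0; field.
by rewrite EA0 k0 E0 D0.
Qed.

Lemma opnorm_line (L : T -> T) u : (forall k v, L (k *: v) = k *: L v) ->
  u != 0 -> opnorm L <[u]>%VS = hnorm (L u) / hnorm u.
Proof.
move=> LZ u0; rewrite /opnorm.
have un0 : hnorm u != 0 by rewrite hnorm_eq0.
rewrite (_ : [set hnorm (L v) | v in _] = [set hnorm (L u) / hnorm u]) ?sup1//.
have kE k : hnorm (k *: u) = 1 -> hnorm (L (k *: u)) = hnorm (L u) / hnorm u.
  rewrite LZ !hnormZ => k1; have -> : normc k = (hnorm u)^-1.
    by apply: (mulIf un0); rewrite k1 mulVf.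
  by rewrite mulrC.
apply/seteqP; split=> [_ [v [/vlineP[k ->] k1] <-]|_ ->]; first exact: kE.
have [k [k1 _]] := normalize u0; exists (k *: u); last exact: kE.
by split=> //; rewrite memvZ// memv_line.
Qed.

End Projective.
(** * Consequences of domination *)

Section DominatedSplitting.
Variable R : realType.
Local Notation C := R[i].
Local Notation T := (C2 R).
Variables (f : henon R) (b : R).
Hypothesis hb : forall x : T, normc (\det ('J (henon_map f) x)) = b.

Let J := julia f.

Lemma proj_diff_line (n : int) x (w : T) :
  proj_diff f n x <[w]>%VS = <[w *m jac f n x]>%VS.
Proof. by rewrite /proj_diff limg_line lfunE /= diff_jac. Qed.

Lemma opnorm_jac (n : int) x (u : T) : u != 0 ->
  opnorm ('d (henon_iter f n) x) <[u]>%VS = hnorm (u *m jac f n x) / hnorm u.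
Proof.
move=> u0; rewrite -diff_jac; apply: opnorm_line => // k v.
exact: linearZ.
Qed.

Lemma det_jac_neq0 (n : int) x : \det (jac f n x) != 0.
Proof.
by rewrite -normc_gt0 (det_jac hb) exprz_gt0// (henon_det_gt0 hb).
Qed.

Lemma sph_deriv_jac (n : int) x (u : T) : u != 0 ->
  sph_deriv (proj_diff f n x) <[u]>%VS =
  b ^ n * hnorm u ^+ 2 / hnorm (u *m jac f n x) ^+ 2.
Proof.
move=> u0; rewrite (sph_deriv_line (proj_diff_line n x) (det_jac_neq0 n x) u0).
by rewrite (det_jac hb).
Qed.

Lemma jacK (n : int) x (v : T) :
  v *m jac f n x *m jac f (- n) (henon_iter f n x) = v.
Proof. by rewrite -mulmxA -jacD addNr jac0 mulmx1. Qed.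


Lemma jac_neq0 (n : int) x (v : T) : v != 0 -> v *m jac f n x != 0.
Proof. by apply: contra_neq => vB; rewrite -(jacK n x v) vB mul0mx. Qed.

Lemma wedge_jac (n : int) x (v w : T) :
  normc (wedge (v *m jac f n x) (w *m jac f n x)) = normc (wedge v w) * b ^ n.
Proof. by rewrite wedge_mul normcM (det_jac hb). Qed.

Lemma jac_lower_bound (n : int) :
  exists2 M : R, 1 <= M & forall x v, J x ->
    hnorm v <= M * hnorm (v *m jac f n x).
Proof.
have [M M1 MP] := jac_bound f (- n); exists M; first exact: M1.
move=> x v Jx; have := MP _ (v *m jac f n x) (julia_invariant n Jx).
by rewrite (jacK n x v).
Qed.

Section FromDomination.
Variables (E F : T -> {vspace T}) (l : nat).
Hypothesis EF : forall z, J z -> [/\ \dim (E z) = 1%N, \dim (F z) = 1%N,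
  (E z + F z = fullv)%VS & (E z :&: F z = 0)%VS].
Hypothesis EF_inv : forall z, J z ->
  (linfun ('d (henon_map f) z) @: E z)%VS = E (henon_map f z) /\
  (linfun ('d (henon_map f) z) @: F z)%VS = F (henon_map f z).
Hypothesis l_gt0 : (1 <= l)%N.
Hypothesis EF_dom : forall z, J z ->
  let w := henon_iter f l%:Z z in
  opnorm ('d (henon_iter f l%:Z) z) (E z) *
  opnorm ('d (henon_iter f (- l%:Z)) w) (F w) < 2^-1.

(** The differentials are invertible, so membership in an invariant field of
    subspaces can be tested after pushing forward. *)
Lemma line_image (G : T -> {vspace T}) (n : nat) z :
  (forall y, J y -> (linfun ('d (henon_map f) y) @: G y)%VS = G (henon_map f y)) ->
  J z -> forall v, (v *m jac f n z \in G (henon_iter f n z)) = (v \in G z).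
Proof.
move=> Ginv Jz; elim: n => [|n IH] v; first by rewrite jac0 mulmx1.
have Jn : J (henon_iter f n z) by exact: julia_invariant.
rewrite -(IH v) -(addn1 n) PoszD addrC jacD mulmxA henon_iterD.
move: (v *m _) (henon_iter f n z) Jn => w y Jy.
have dE u : linfun ('d (henon_map f) y) u = u *m jac f 1 y.
  by rewrite lfunE /= -diff_jac.
have -> : G (henon_iter f 1 y) = (linfun ('d (henon_map f) y) @: G y)%VS.
  exact/esym/Ginv.
apply/memv_imgP/idP => [[u uG]|wG]; last by exists w.
by rewrite dE => /(congr1 (fun v => v *m jac f (- 1) (henon_iter f 1 y)));
  rewrite !jacK => ->.
Qed.

Lemma E_image (n : nat) z : J z -> forall v,
  (v *m jac f n z \in E (henon_iter f n z)) = (v \in E z).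
Proof. by move=> Jz; apply: line_image => // y Jy; have [] := EF_inv Jy. Qed.

Lemma F_image (n : nat) z : J z -> forall v,
  (v *m jac f n z \in F (henon_iter f n z)) = (v \in F z).
Proof. by move=> Jz; apply: line_image => // y Jy; have [] := EF_inv Jy. Qed.

Lemma dim1_span (U : {vspace T}) (u : T) : \dim U = 1%N -> u \in U -> u != 0 ->
  U = <[u]>%VS.
Proof.
move=> dU uU u0; apply/eqP.
by rewrite eq_sym eqEdim dU dim_vline u0 andbT -memvE.
Qed.

(** The domination inequality on vectors: on the line [F] the operator norm of
    the inverse is the inverse of the dilation. *)
Lemma domination_step z (e u : T) : J z -> e \in E z -> u \in F z ->
  2 * (hnorm (e *m jac f l z) * hnorm u) <= hnorm e * hnorm (u *m jac f l z).
Proof.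
move=> Jz eE uF; have [Ed Fd _ _] := EF Jz.
have [->|e0] := eqVneq e 0; first by rewrite mul0mx hnorm0 !mul0r mulr0.
have [->|u0] := eqVneq u 0; first by rewrite mul0mx hnorm0 !mulr0.
set w := henon_iter f l z.
have Jw : J w by exact: julia_invariant.
have [_ Fdw _ _] := EF Jw.
have uA0 : u *m jac f l z != 0 by exact: jac_neq0.
have uAF : u *m jac f l z \in F w by rewrite (F_image l Jz).
have oE : opnorm ('d (henon_iter f l) z) (E z) = hnorm (e *m jac f l z) / hnorm e.
  by rewrite (dim1_span Ed eE e0); exact: opnorm_jac.
have oF : opnorm ('d (henon_iter f (- l%:Z)) w) (F w) =
    hnorm u / hnorm (u *m jac f l z).
  by rewrite (dim1_span Fdw uAF uA0) (opnorm_jac _ _ uA0) jacK.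
have : hnorm (e *m jac f l z) / hnorm e * (hnorm u / hnorm (u *m jac f l z)) < 2^-1.
  by rewrite -oE -oF; exact: (EF_dom Jz).
rewrite -!hnorm_gt0 in e0 u0 uA0.
set eA := hnorm (e *m _); set uA := hnorm (u *m _) in uA0 *.
rewrite mulf_div ltr_pdivrMr ?mulr_gt0// => /ltW.
by rewrite ler_pdivlMl// ; lra.
Qed.

Lemma domination_iter (n : nat) z (e u : T) : J z -> e \in E z -> u \in F z ->
  2 ^+ n * (hnorm (e *m jac f (l * n)%N z) * hnorm u) <=
  hnorm e * hnorm (u *m jac f (l * n)%N z).
Proof.
move=> Jz eE uF; elim: n => [|n IH].
  by rewrite muln0 expr0 mul1r jac0 !mulmx1.
have [->|u0] := eqVneq u 0; first by rewrite mul0mx hnorm0 !mulr0.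
rewrite mulnS PoszD jacD !mulmxA.
have Jw : J (henon_iter f (l * n)%N z) by exact: julia_invariant.
have := domination_step Jw (etrans (E_image _ Jz e) eE) (etrans (F_image _ Jz u) uF).
have : 0 < hnorm (u *m jac f (l * n)%N z) by rewrite hnorm_gt0 jac_neq0.
move: IH (hnorm_ge0 u); rewrite exprS.
have : 0 <= (2 : R) ^+ n by rewrite exprn_ge0.
move: (jac f (l * n)%N z) (jac f l (henon_iter f (l * n)%N z)) => A B.
have := hnorm_ge0 (u *m A *m B).
move: (hnorm (e *m A *m B)) (hnorm (u *m A *m B)) (hnorm (e *m A)) (hnorm (u *m A)).
move: (hnorm e) (hnorm u) (2 ^+ n) => e1 u1 p eA' uA' eA uA uA'0 p0 IH u10 uA0 st.
rewrite -(ler_pM2r uA0).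
have := ler_wpM2l (mulr_ge0 p0 u10) st; have := ler_wpM2r uA'0 IH; lra.
Qed.

(** The multiple that cancels the larger coordinate of [u] leaves only the area
    spanned by the two vectors. *)
Lemma near_multiple (e u : T) : hnorm u = 1 ->
  exists k : C, hnorm (e - k *: u) <= 2 * normc (wedge e u).
Proof.
move=> u1; have us := hnorm_le_sum u; rewrite u1 in us.
have [u0|u0] := leP 2^-1 (normc (u 0 0)).
  have u00 : u 0 0 != 0 by rewrite -normc_gt0; lra.
  exists (e 0 0 / u 0 0); apply: le_trans (hnorm_le_sum _) _; rewrite !mxE.
  rewrite divfK// subrr normc0 add0r.
  have -> : e 0 1 - e 0 0 / u 0 0 * u 0 1 = - (wedge e u / u 0 0).
    by rewrite /wedge; field.
  rewrite normcN normcM normcV mulrC ler_wpM2r//.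
  by rewrite invf_ple ?posrE// (lt_le_trans _ u0)// invr_gt0.
have u1' : 2^-1 <= normc (u 0 1) by lra.
have u01 : u 0 1 != 0 by rewrite -normc_gt0; lra.
exists (e 0 1 / u 0 1); apply: le_trans (hnorm_le_sum _) _; rewrite !mxE.
rewrite divfK// subrr normc0 addr0.
have -> : e 0 0 - e 0 1 / u 0 1 * u 0 0 = wedge e u / u 0 1.
  by rewrite /wedge; field.
rewrite normcM normcV mulrC ler_wpM2r//.
by rewrite invf_ple ?posrE// (lt_le_trans _ u1')// invr_gt0.
Qed.

(** Two lines at a small angle cannot be dilated at rates that differ by a
    factor of two, so domination bounds the angle from below. *)
Lemma angle_bound : exists2 d : R, 0 < d & forall z (e u : T), J z ->
  e \in E z -> u \in F z -> d * (hnorm e * hnorm u) <= normc (wedge e u).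
Proof.
have [M M1 MP] := jac_bound f l; have [M' M1' MP'] := jac_lower_bound l.
have M0 : 0 < M by lra.
have M0' : 0 < M' by lra.
pose d := (8 * M * M')^-1.
have d0 : 0 < d by rewrite invr_gt0 !mulr_gt0.
exists d; first exact: d0.
move=> z e u Jz eE uF.
have [->|e0] := eqVneq e 0; first by rewrite hnorm0 mul0r mulr0.
have [->|u0] := eqVneq u 0; first by rewrite hnorm0 !mulr0.
have [k [e1 kE]] := normalize e0; have [k' [u1 kE']] := normalize u0.
rewrite -ler_pdivlMr ?mulr_gt0 ?hnorm_gt0//.
rewrite invfM -kE -kE' [normc k * _]mulrC mulrA -normcM mulrC -[k']mulr1.
rewrite mulr1 mulrC -normcM.
have -> : wedge e u * k' * k = wedge (k *: e) (k' *: u).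
  by rewrite wedgeZl wedgeZr; ring.
have {}eE : k *: e \in E z by rewrite memvZ.
have {}uF : k' *: u \in F z by rewrite memvZ.
move: (k *: e) (k' *: u) e1 u1 eE uF => {}e {}u e1 u1 eE uF {k k' kE kE' e0 u0}.
rewrite leNgt; apply/negP => wd.
have [k ku] := near_multiple e u1.
have st := domination_step Jz eE uF; rewrite e1 u1 mul1r mulr1 in st.
have uA : 1 <= M' * hnorm (u *m jac f l z).
  by have := MP' _ u Jz; rewrite u1.
have kA : normc k * hnorm (u *m jac f l z) - hnorm (e *m jac f l z) <=
    M * (2 * normc (wedge e u)).
  rewrite -hnormZ scalemxAl; apply: le_trans (ler_hnormB _ _) _.
  rewrite hnormBC -mulmxBl; apply: le_trans (MP _ _ Jz) _.
  by rewrite ler_wpM2l// ltW.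
have k1 : 1 - 2 * normc (wedge e u) <= normc k.
  have := ler_hnormB e (k *: u); rewrite hnormZ e1 u1; lra.
have dM : d * (M * M') = 1 / 8.
  by rewrite /d; field; rewrite !gt_eqF.
have d8 : d <= 1 / 8.
  rewrite -dM ler_peMr ?(ltW d0)//.
  by rewrite -[1]mulr1 ler_pM.
set a := hnorm (u *m _) in st uA kA; set c := hnorm (e *m _) in st kA.
set o := normc (wedge e u) in wd ku kA k1; have o0 : 0 <= o by exact: normc_ge0.
have a0 : 0 <= a by exact: hnorm_ge0.
have ka : 3 / 4 * a <= normc k * a by rewrite ler_wpM2r//; lra.
have a4 : a / 4 <= M * (2 * o) by lra.
have : M' * a <= 8 * (M * M') * o by have := ler_wpM2l (ltW M0') a4; lra.
have : 8 * (M * M') * o < 8 * (M * M') * d by rewrite ltr_pM2l ?mulr_gt0.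
lra.
Qed.

(** A vector growing no faster than the square root of the Jacobian in
    backward time lies on the dominating line: off that line vectors
    follow the dominated one, which takes more than its share. *)
Lemma slow_backward_in_F x (v : T) : J x ->
  (forall n : nat, hnorm (v *m jac f (- n%:Z) x) ^+ 2 <= b ^ (- n%:Z) * hnorm v ^+ 2) ->
  v \in F x.
Proof.
move=> Jx vn; have b0 := henon_det_gt0 hb.
have [Ed Fd _ _] := EF Jx; have [e e0 Ee] := line_of_dim1 Ed.
have [u u0 Fu] := line_of_dim1 Fd; rewrite Fu.
have eE : e \in E x by rewrite Ee memv_line.
have uF : u \in F x by rewrite Fu memv_line.
have [d d0 dP] := angle_bound.
suff : wedge u v = 0.
  by move=> /(wedge_eq0 u0)[k ->]; rewrite memvZ// memv_line.
rewrite wedgeC; apply/eqP; rewrite oppr_eq0; apply/negPn/negP => vu.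
have {vu} o0 : 0 < normc (wedge v u) ^+ 2 by rewrite exprn_gt0// normc_gt0.
rewrite -!hnorm_gt0 in e0 u0.
pose C1 := hnorm v ^+ 2 * (normc (wedge e u) * hnorm u / (d * hnorm e)).
have [|n] := @geometric_small R 2 C1 _ _ o0; first by rewrite ltr1n.
apply/negP; rewrite -leNgt ler_pdivlMr ?exprn_gt0//.
set m := (l * n)%N; set y := henon_iter f (- m%:Z) x.
have Jy : J y by exact: julia_invariant.
have yx : henon_iter f m y = x by rewrite -henon_iterD subrr.
pose en := e *m jac f (- m%:Z) x; pose un := u *m jac f (- m%:Z) x.
have enK : en *m jac f m y = e.
  by have := jacK (- m%:Z) x e; rewrite opprK.
have unK : un *m jac f m y = u.
  by have := jacK (- m%:Z) x u; rewrite opprK.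
have enE : en \in E y by rewrite -(E_image m Jy) enK yx.
have unF : un \in F y by rewrite -(F_image m Jy) unK yx.
have dom := domination_iter n Jy enE unF; rewrite -/m enK unK in dom.
have ang := dP y en un Jy enE unF.
have wE := wedge_jac (- m%:Z) x e u; rewrite -/en -/un in wE.
have wV := wedge_jac (- m%:Z) x v u; rewrite -/un in wV.
have wVle := ler_wedge (v *m jac f (- m%:Z) x) un; rewrite wV in wVle.
have vm := vn m.
have bm : 0 < b ^ (- m%:Z) by rewrite exprz_gt0.
rewrite wE in ang.
move: dom ang wVle vm bm o0; rewrite /C1.
have := hnorm_ge0 en; have := hnorm_ge0 un; have := normc_ge0 (wedge e u).
have := normc_ge0 (wedge v u); have := hnorm_ge0 (v *m jac f (- m%:Z) x).
have : 0 < (2 : R) ^+ n by rewrite exprn_gt0.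
move: (hnorm en) (hnorm un) (normc (wedge e u)) (normc (wedge v u))
  (hnorm (v *m _)) (hnorm e) (hnorm u) (hnorm v) (b ^ _) (2 ^+ n) e0 u0.
move=> E' U' w o V e1 u1 v1 B p e10 u10 p0 V0 o0 w0 U0 E0 dom ang ov vB B0 oo.
(* The images of the two lines share the determinant and make an angle bounded
   below, so domination leaves the dominating vector only a small share. *)
have UU : p * U' ^+ 2 <= w * u1 / (d * e1) * B.
  rewrite mulrAC ler_pdivlMr ?mulr_gt0//.
  have h1 : p * (e1 * U') * (d * U') <= E' * u1 * (d * U').
    by rewrite ler_wpM2r// mulr_ge0// ltW.
  have h2 : d * (E' * U') * u1 <= w * B * u1 by rewrite ler_wpM2r// ltW.
  lra.
have oB : (o * B) ^+ 2 <= (V * U') ^+ 2.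
  by rewrite lerXn2r// nnegrE mulr_ge0// ltW.
have VU : p * (V * U') ^+ 2 <= (B * v1 ^+ 2) * (w * u1 / (d * e1) * B).
  rewrite exprMn mulrCA; apply: ler_pM => //; first exact: sqr_ge0.
  by rewrite mulr_ge0 ?sqr_ge0// ltW.
have : (o ^+ 2 * p) * B ^+ 2 <= v1 ^+ 2 * (w * u1 / (d * e1)) * B ^+ 2.
  have := ler_wpM2l (ltW p0) oB; rewrite exprMn; lra.
by rewrite ler_pM2r// exprn_gt0.
Qed.

(** By the angle bound every vector splits along the two lines with bounded
    coefficients, and the dominated part does not exceed the other. The constant
    does not depend on the time, so it is absorbed by a long enough iterate. *)
Lemma F_controls_norm : exists2 c : R, 0 < c &
  forall (n : nat) z (v w : T), J z -> v \in F z ->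
  hnorm (w *m jac f (l * n)%N z) * hnorm v <=
  c * hnorm (v *m jac f (l * n)%N z) * hnorm w.
Proof.
have [d d0 dP] := angle_bound; exists (2 / d); first by rewrite divr_gt0.
move=> n z v w Jz vF.
have [Ed _ _ _] := EF Jz; have [e e0 Ee] := line_of_dim1 Ed.
have eE : e \in E z by rewrite Ee memv_line.
have dom := domination_iter n Jz eE vF.
set A := jac f (l * n)%N z in dom *.
have {}dom : hnorm (e *m A) * hnorm v <= hnorm e * hnorm (v *m A).
  apply: le_trans dom; rewrite ler_peMl ?mulr_ge0 ?hnorm_ge0//.
  by rewrite exprn_ege1// ler1n.
have ang := dP z e v Jz eE vF.
have cr : normc (wedge e v) * hnorm (w *m A) <=
    hnorm w * hnorm v * hnorm (e *m A) + hnorm e * hnorm w * hnorm (v *m A).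
  rewrite -hnormZ scalemxAl wedge_cramer mulmxDl.
  apply: le_trans (ler_hnormD _ _) _; rewrite -!scalemxAl !hnormZ.
  by apply: lerD; rewrite ler_wpM2r ?hnorm_ge0 ?ler_wedge.
rewrite -hnorm_gt0 in e0; clear Ee eE.
have := ler_wpM2r (hnorm_ge0 (w *m A)) ang; have := ler_wpM2r (hnorm_ge0 w) dom.
move: cr e0 {ang dom vF}; clearbody A.
move: (hnorm (e *m A)) (hnorm (v *m A)) (hnorm (w *m A)) (hnorm e) (hnorm v).
move: (hnorm w) (normc _) => w1 o eA vA wA e1 v1 cr e10 dom ang.
rewrite -(ler_pM2l e10) -(ler_pM2l d0).
have -> : d * (e1 * (2 / d * vA * w1)) = 2 * (e1 * vA * w1).
  by field; rewrite gt_eqF.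
lra.
Qed.

(** The norms of a long iterate are comparable to its dilations along [F], whose
    product telescopes. *)
Lemma F_not_contracting x (v : T) (q : R) : J x -> v != 0 -> v \in F x ->
  0 < q < 1 ->
  ~ (forall n : nat, hnorm (v *m jac f n x) <= q ^+ n * hnorm v).
Proof.
move=> Jx v0 vF /andP[q0 q1] vq.
have [c c0 cP] := F_controls_norm.
have q1' : 1 < (q ^+ l)^-1.
  by rewrite invf_gt1 ?exprn_gt0// exprn_ilt1// ?ltW// -lt0n.
have half : 0 < 2^-1 :> R by rewrite invr_gt0.
have [k0 k0P] := geometric_small c q1' half.
pose k := k0.+1; pose N := (l * k)%N.
have cq : c * q ^+ N <= 2^-1.
  rewrite /N exprM /k exprS mulrCA; apply: le_trans (_ : c * (q ^+ l) ^+ k0 <= _).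
    rewrite ler_piMl ?mulr_ge0 ?exprn_ge0 ?(ltW c0) ?(ltW q0)//.
    by rewrite exprn_ile1// ltW.
  by move: k0P; rewrite exprVn invrK => /ltW.
have N0 : (0 < N)%N by rewrite /N muln_gt0 l_gt0.
have cN z (u w : T) : J z -> u \in F z ->
    hnorm (w *m jac f N z) * hnorm u <= c * hnorm (u *m jac f N z) * hnorm w.
  exact: (cP k).
clearbody N.
have [a aE] : exists a : nat -> R, forall j, a j = hnorm (v *m jac f (N * j)%N x).
  by eexists.
have a0 j : 0 < a j by rewrite aE hnorm_gt0 jac_neq0.
have aS j : a j.+1 = hnorm (v *m jac f (N * j)%N x *m jac f N (henon_iter f (N * j)%N x)).
  by rewrite aE mulnS PoszD jacD mulmxA.
have Jj j : J (henon_iter f (N * j)%N x) by exact: julia_invariant.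
have [M M1 MP] := jac_lower_bound N.
have M0 : 0 < M := lt_le_trans ltr01 M1.
have aM j : a j <= M * a j.+1 by rewrite (aS j) (aE j); exact: (MP _ _ (Jj j)).
have prodE n : \prod_(j < n) (c * (a j.+1 / a j)) = c ^+ n * (a n / a 0%N).
  elim: n => [|n IH]; first by rewrite big_ord0 expr0 mul1r divff// gt_eqF.
  rewrite big_ord_recr /= IH exprS; field.
  by rewrite !gt_eqF.
apply: (@julia_not_contracting R f x N (fun j => c * (a j.+1 / a j)) 1 2^-1 (c / M)
  Jx N0).
- by rewrite divr_gt0.
- by rewrite half invf_lt1 ?ltr1n.
- move=> j; rewrite ler_pM2l// ler_pdivlMr// mulrC ler_pdivrMr// mulrC.
  exact: aM.
- move=> j w; have vFj : v *m jac f (N * j)%N x \in F (henon_iter f (N * j)%N x).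
    by rewrite F_image.
  have h := cN _ _ w (Jj j) vFj.
  have -> : c * (a j.+1 / a j) * hnorm w = c * a j.+1 * hnorm w / a j by ring.
  by rewrite ler_pdivlMr// (aS j) (aE j); exact: h.
- move=> n; rewrite prodE mul1r.
  have -> : a 0%N = hnorm v by rewrite aE muln0 jac0 mulmx1.
  apply: le_trans (_ : c ^+ n * q ^+ (N * n) <= _).
    rewrite ler_wpM2l ?exprn_ge0 ?(ltW c0)// ler_pdivrMr ?hnorm_gt0//.
    by rewrite aE; exact: vq.
  by rewrite exprM -exprMn lerXn2r// nnegrE ?mulr_ge0 ?exprn_ge0 ?ltW.
Qed.

End FromDomination.

End DominatedSplitting.
(** * The equivalence *)

Section FromHyperbolicity.
Variable R : realType.
Local Notation C := R[i].
Local Notation T := (C2 R).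
Variables (f : henon R) (b : R).
Hypothesis hb : forall x : T, normc (\det ('J (henon_map f) x)) = b.

(** Along a critical direction the backward estimate puts the vector on the
    dominating line, and the forward estimate makes that line contract. *)
Lemma dominated_no_Crit (beta_m beta_p : R) : dominated_splitting f (julia f) ->
  b < beta_p -> beta_p <= beta_m -> beta_m < 1 -> Crit f beta_m beta_p = set0.
Proof.
move=> [E [F [EF EFinv [l l0 dom]]]] bp pm m1; have b0 := henon_det_gt0 hb.
apply/seteqP; split=> // x [Jx [xi dxi cr]].
have [v v0 vE] := line_of_dim1 dxi; subst xi.
have vA n : 0 < hnorm (v *m jac f n x) by rewrite hnorm_gt0 jac_neq0.
have p0 : 0 < beta_p by exact: lt_trans bp.
have m0 : 0 < beta_m by exact: lt_le_trans pm.
have v1 : 0 < hnorm v by rewrite hnorm_gt0.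
have vF : v \in F x.
  apply: (slow_backward_in_F hb EF EFinv dom Jx) => n.
  have [_] := cr n; rewrite (sph_deriv_jac hb)// ler_pdivlMr ?exprn_gt0// => h.
  apply: le_trans h; rewrite ler_peMl ?exprn_ge0//.
  by rewrite invf_ge1 ?exprn_gt0// exprn_ile1// ltW.
pose q := Num.sqrt (b / beta_p).
have bp0 : 0 < b / beta_p by rewrite divr_gt0.
have q2 : q ^+ 2 = b / beta_p by rewrite sqr_sqrtr// ltW.
have q0 : 0 < q by rewrite sqrtr_gt0.
have q1 : q < 1.
  rewrite -(@ltr_pXn2r _ 2)// ?nnegrE ?ltW// expr1n q2.
  by rewrite ltr_pdivrMr// mul1r.
have q01 : 0 < q < 1 by rewrite q0.
apply: (F_not_contracting EF EFinv l0 dom Jx v0 vF q01).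
move=> n; have [+ _] := cr n.
rewrite (sph_deriv_jac hb)// ler_pdivlMr ?exprn_gt0// => h.
rewrite -(@ler_pXn2r _ 2)// ?nnegrE ?mulr_ge0 ?exprn_ge0// ?(ltW q0)//.
rewrite exprMn -exprM mulnC exprM q2 expr_div_n mulrAC ler_pdivlMr ?exprn_gt0//.
by rewrite mulrC.
Qed.

Lemma wedge_splitting (v w : T) : wedge v w != 0 ->
  [/\ \dim <[v]>%VS = 1%N, \dim <[w]>%VS = 1%N,
      (<[v]> + <[w]> = fullv)%VS & (<[v]> :&: <[w]> = 0)%VS].
Proof.
move=> vw.
have v0 : v != 0 by apply: contra_neq vw => ->; rewrite /wedge !mxE !mul0r subrr.
have w0 : w != 0 by apply: contra_neq vw => ->; rewrite /wedge !mxE !mulr0 subrr.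
have I0 : (<[v]> :&: <[w]> = 0)%VS.
  apply/eqP; rewrite -subv0; apply/subvP => z; rewrite memv_cap memv0.
  case/andP => /vlineP[k zk] /vlineP[k' zk'].
  have : k * wedge v w = 0 by rewrite -wedgeZl -zk zk' wedgeZl /wedge; ring.
  by move=> /eqP; rewrite mulf_eq0 (negbTE vw) orbF zk => /eqP ->; rewrite scale0r.
split; rewrite ?dim_vline ?v0 ?w0//.
apply/eqP; rewrite eqEdim subvf dimv_disjoint_sum// !dim_vline v0 w0 dimvf.
by rewrite /dim /= mul1n.
Qed.

Lemma collinear_line (v w : T) : v != 0 -> w != 0 -> wedge v w = 0 ->
  <[v]>%VS = <[w]>%VS.
Proof.
move=> v0 w0 /(wedge_eq0 v0)[k wE]; apply/eqP.
rewrite eq_sym eqEdim !dim_vline v0 w0 andbT -memvE wE memvZ//.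
exact: memv_line.
Qed.

(** The rescaling factors cancel in the product that defines domination. *)
Lemma rate_product (s t a c a1 c1 : R) : 0 < s -> 0 < t -> s * t = 1 ->
  0 <= a -> 0 <= c -> 0 < a1 -> 0 < c1 ->
  s * a <= 2^-1 * a1 -> t * c <= 2^-1 * c1 -> a / a1 * (c / c1) < 2^-1.
Proof.
move=> s0 t0 st a0 c0 a10 c10 sa tc.
rewrite mulf_div ltr_pdivrMr ?mulr_gt0//.
have := ler_pM (mulr_ge0 (ltW s0) a0) (mulr_ge0 (ltW t0) c0) sa tc.
have -> : s * a * (t * c) = a * c by rewrite mulrACA st mul1r.
have := mulr_gt0 a10 c10; lra.
Qed.

(** Rescaled by the powers of the square root of beta / b, a norm-maximal vector
    is exactly a critical direction for the pair (beta, beta), while the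
    determinants stay at most one. *)
Lemma no_Crit_dominated (beta : R) : b < beta -> beta < 1 ->
  Crit f beta beta = set0 -> dominated_splitting f (julia f).
Proof.
move=> bb b1 noCrit; have b0 := henon_det_gt0 hb.
have beta0 : 0 < beta := lt_trans b0 bb.
pose r := Num.sqrt (beta / b).
have r2 : r ^+ 2 = beta / b by rewrite sqr_sqrtr// ltW// divr_gt0.
have r0 : 0 < r by rewrite sqrtr_gt0 divr_gt0.
have rn0 n : 0 < r ^ n by rewrite exprz_gt0.
have r1 : 1 <= r.
  rewrite -(@ler_pXn2r _ 2)// ?nnegrE ?ler01 ?(ltW r0)// expr1n r2.
  by rewrite ler_pdivlMr// mul1r ltW.
have rn2 (n : int) : (r ^ n) ^+ 2 * b ^ n = beta ^ n.
  rewrite -[(r ^ n) ^+ 2]/((r ^ n) ^ 2%:Z) exprzAC -[r ^ 2]/(r ^+ 2) r2.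
  by rewrite -expfzMl divfK// gt_eqF.
pose B (n : int) x : 'M[C]_2 := (r ^ n)%:C *: jac f n x.
have BE n x (v : T) : hnorm (v *m B n x) = r ^ n * hnorm (v *m jac f n x).
  by rewrite /B -scalemxAr hnormZ normc_real ger0_norm// ltW.
have B0 x : B 0 x = 1%:M by rewrite /B jac0 expr0z scale1r.
have BD m n x : B (m + n) x = B n x *m B m (henon_iter f n x).
  rewrite /B jacD -scalemxAl -scalemxAr scalerA -rmorphM -expfzDr ?gt_eqF//.
  by rewrite addrC.
have Bc n i j : continuous (fun x => B n x i j).
  rewrite (_ : (fun x => _) = fun x => (r ^ n)%:C * jac f n x i j).
    apply: continuous_mulc; first exact: cst_continuous.
    exact: jac_continuous.
  by apply/funext => x; rewrite mxE.
have Bdet (n : nat) x : normc (\det (B n x)) <= 1.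
  rewrite detZ normcM normcX normc_real gtr0_norm ?rn0// (det_jac hb) rn2.
  by rewrite -[beta ^ n]/(beta ^+ n) exprn_ile1 ?(ltW beta0) ?(ltW b1).
have unscale z (u u' : T) :
    wedge (u *m B 1 z) u' = 0 -> wedge (u *m jac f 1 z) u' = 0.
  have k0 : (r ^ 1)%:C != 0 :> C by rewrite -normc_gt0 normc_real gtr0_norm rn0.
  rewrite /B -scalemxAr wedgeZl => /eqP; rewrite mulf_eq0 (negbTE k0) /=.
  by move/eqP.
clearbody B.
have no_peak x (v : T) : julia f x -> v != 0 ->
    exists n, hnorm v < hnorm (v *m B n x).
  move=> Jx v0; apply: contrapT => peak.
  suff : Crit f beta beta x by rewrite noCrit.
  split=> //; exists <[v]>%VS; first by rewrite dim_vline v0.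
  have key (n : int) : beta ^ n <= sph_deriv (proj_diff f n x) <[v]>%VS.
    rewrite (sph_deriv_jac hb)// ler_pdivlMr ?exprn_gt0 ?hnorm_gt0 ?jac_neq0//.
    rewrite -rn2 mulrAC -exprMn -BE mulrC ler_pM2l ?exprz_gt0//.
    rewrite ler_pXn2r ?nnegrE// leNgt; apply/negP => vB.
    by apply: peak; exists n.
  by move=> n; split; [exact: key n%:Z|rewrite exprnN; exact: key].
have no_sink x : julia f x -> forall n : nat, ~ (forall (m : nat) (v : T),
    hnorm (v *m B n (henon_iter f m x)) <= 2^-1 * hnorm v).
  move=> Jx n half; have half0 : 0 < 2^-1 :> R by rewrite invr_gt0.
  have n0 : (0 < n)%N.
    rewrite lt0n; apply/negP => /eqP n0; have := half 0%N (pt 1 0).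
    rewrite n0 B0 mulmx1 hnorm_pt normc1 normc0 expr1n expr0n /= addr0 sqrtr1.
    lra.
  apply: (@julia_not_contracting R f x n (fun=> 2^-1) 1 2^-1 2^-1 Jx n0 half0).
  - by rewrite half0 invf_lt1 ?ltr1n.
  - by move=> j; exact: lexx.
  - move=> j v; apply: le_trans (half (n * j)%N v); rewrite BE.
    by rewrite ler_peMl// -[r ^ n]/(r ^+ n) exprn_ege1.
  - by move=> k; rewrite prodr_const card_ord mul1r.
have [v [w [vw inv small]]] := quasi_Anosov_splitting (@julia_compact R f)
  (@julia_invariant R f) (fun x => erefl) (henon_iterD f) B0 BD Bc Bdet
  no_peak no_sink.
have v0 x : julia f x -> v x != 0.
  by move=> Jx; apply: contra_neq (vw x Jx) => ->; rewrite /wedge !mxE !mul0r subrr.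
have w0 x : julia f x -> w x != 0.
  by move=> Jx; apply: contra_neq (vw x Jx) => ->; rewrite /wedge !mxE !mulr0 subrr.
exists (fun x => <[v x]>%VS), (fun x => <[w x]>%VS); split.
- by move=> z Jz; exact: wedge_splitting (vw z Jz).
- move=> z Jz; have Jfz : julia f (henon_map f z) by exact: (julia_invariant 1 Jz).
  have dE u : linfun ('d (henon_map f) z) u = u *m jac f 1 z.
    by rewrite lfunE /= -diff_jac.
  have [vi wi] := inv z Jz.
  split; rewrite limg_line dE; apply: collinear_line.
  + by apply: jac_neq0; exact: v0.
  + exact: v0.
  + exact: unscale.
  + by apply: jac_neq0; exact: w0.
  + exact: w0.
  + exact: unscale.
have half0 : 0 < 2^-1 :> R by rewrite invr_gt0.
have [l l0 lP] := small 2^-1 half0; exists l => // z Jz.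
set y := henon_iter f l z; have Jy : julia f y by exact: julia_invariant.
have oE := opnorm_jac f l z (v0 z Jz).
have oF := opnorm_jac f (- l%:Z) y (w0 y Jy).
apply: (@eq_ind_r _ _ (fun t => t < 2^-1) _ _ (congr2 *%R oE oF)).
have [vl _] := lP z Jz; have [_ wl] := lP y Jy.
rewrite (BE l z) in vl; rewrite (BE (- l%:Z) y) in wl.
have rr : r ^ l * r ^ (- l%:Z) = 1 by rewrite -expfzDr ?gt_eqF// subrr expr0z.
apply: (rate_product (rn0 l) (rn0 (- l%:Z)) rr _ _ _ _ vl wl);
  rewrite ?hnorm_ge0 ?hnorm_gt0//; [exact: v0|exact: w0].
Qed.

End FromHyperbolicity.

Theorem mainTheorem1 (R : realType) (f : henon R) (b : R)
    (hb : forall x : C2 R, normc (\det ('J (henon_map f) x)) = b)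
    (hb1 : b < 1) :
  dominated_splitting f (julia f) <->
  forall beta_m beta_p : R,
    b < beta_p -> beta_p <= beta_m -> beta_m < 1 ->
    Crit f beta_m beta_p = set0.
Proof.
split=> [dom beta_m beta_p|noCrit]; first exact: dominated_no_Crit.
(* Any value strictly between b and 1 would do. *)
have bm : b < (b + 1) / 2 by lra.
have m1 : (b + 1) / 2 < 1 by lra.
exact: (no_Crit_dominated hb bm m1 (noCrit _ _ bm (lexx _) m1)).
Qed.
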